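(* There is an absolute constant $c>0$ such that for every $n\in\mathbb{N}$, if $A$ is drawn uniformly at random from the set of all $n\times n$ symmetric matrices with entries in $\{-1,1\}$, then \[\mathbb{P}(\det(A)=0)\le e^{-cn}.\] *)

(* Defs.v *)
From mathcomp Require Import all_boot all_algebra.
Set Implicit Arguments. Unset Strict Implicit. Unset Printing Implicit Defensive.
Import GRing.Theory.
Local Open Scope ring_scope.

Definition signmx (n : nat) (B : 'M[bool]_n) : 'M[int]_n :=
  \matrix_(i, j) (if B i j then 1 else -1).

Definition sym_sign (n : nat) : {set 'M[bool]_n} :=
  [set B : 'M[bool]_n | B^T == B].

Definition sym_sign_singular (n : nat) : {set 'M[bool]_n} :=
  [set B in sym_sign n | \det (signmx B) == 0].

(* Main.v *)
(** The proof is a 3-adic form of the argument of Campos, Jenssen, Michelen and Sahasrabudhe.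

    Let [A v = t w] with [v] an integer vector not divisible by 3; [v] is allowed to be any kernel
    vector, or a multiple of [A^-1 w]. Modulo 3, few such [v] are sparse, and these are excluded by a
    union bound. Otherwise choose [d] coordinates [D] where [v] is a unit, and let [H] be a random
    [D^c x D] block with lazy entries (0 with probability 15/16). By Fourier inversion,
    [P (A v = t w mod N) <= P (H v_D = 0, H^T v_(D^c) = 0 mod N) =: pi_N v], while the n-th power of
    the largest atom of [sum_i +-v_i mod N] is at most [pi_N v]. So if that atom exceeds [L / 3^J],
    there is a least [N = 3^j] with [pi_N v >= (L/N)^n]; minimality gives [pi_N v < (3L/N)^n] because
    [pi_N] decreases along powers of 3. Exact reduction mod [N] thus replaces the rounding of [v] in
    the real setting, and it remains to see that only [(C N / L^2)^n] residues mod [N] have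
    [pi_N v >= (L/N)^n]. For a typical [v_D] this follows from a second moment over [v_(D^c)]: with
    two copies [H = (H_1, H_2)] the number of solutions of [H^T y = 0] is governed by the rank of [H]
    mod 3, and each loss of rank by one, which costs a factor [N], forces almost all rows of [H] into
    a proper subspace. Multiplying a character by 3 removes the twist by characters of the subspace,
    so this constraint costs each row an independent factor [15/16].

    Hence, outside an event of exponentially small probability, every such [v] has exponentially
    small atoms. The corank of the leading principal minors is then pushed down to zero between sizes
    [n/2] and [n]: when the minor is singular a new random row avoids its row space, and when it is
    invertible the quadratic form deciding singularity is decoupled by flipping the signs in a random
    subset of few coordinates. *)

Require Import Defs.
From Stdlib Require Import Reals.
From mathcomp Require Import all_boot all_order all_algebra.
From mathcomp Require Import zify ring lra Rstruct.
Set Implicit Arguments. Unset Strict Implicit. Unset Printing Implicit Defensive.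
Import Order.TTheory GRing.Theory Num.Theory.
Local Open Scope ring_scope.

(** * Uniform averages over finite types *)

Lemma big_pairE (T : Type) (idx : T) (op : Monoid.com_law idx) (I J : finType)
    (F : I * J -> T) :
  \big[op/idx]_p F p = \big[op/idx]_i \big[op/idx]_j F (i, j).
Proof. by rewrite pair_bigA; apply: eq_bigr => -[]. Qed.

Section Average.
Variable R : realFieldType.
Implicit Types (T : finType).

Definition avg T (f : T -> R) : R := #|T|%:R^-1 * \sum_x f x.

Lemma eq_avg T (f g : T -> R) : f =1 g -> avg f = avg g.
Proof. by move=> fg; rewrite /avg (eq_bigr _ (fun i _ => fg i)). Qed.

Lemma avg_ge0 T (f : T -> R) : (forall x, 0 <= f x) -> 0 <= avg f.
Proof. by move=> f0; rewrite mulr_ge0 ?invr_ge0 ?ler0n ?sumr_ge0. Qed.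

Lemma ler_avg T (f g : T -> R) : (forall x, f x <= g x) -> avg f <= avg g.
Proof.
by move=> fg; rewrite ler_wpM2l ?invr_ge0 ?ler0n //; apply: ler_sum => x _.
Qed.

Lemma avgD T (f g : T -> R) : avg (fun x => f x + g x) = avg f + avg g.
Proof. by rewrite /avg big_split mulrDr. Qed.

Lemma avgMl T a (f : T -> R) : avg (fun x => a * f x) = a * avg f.
Proof. by rewrite /avg -mulr_sumr mulrCA. Qed.

Lemma avgMr T a (f : T -> R) : avg (fun x => f x * a) = avg f * a.
Proof. by rewrite /avg -mulr_suml mulrA. Qed.

Lemma avg_sum T (I : finType) (P : pred I) (f : I -> T -> R) :
  avg (fun x => \sum_(i | P i) f i x) = \sum_(i | P i) avg (f i).
Proof. by rewrite /avg exchange_big mulr_sumr. Qed.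

Lemma avg_const T a : (0 < #|T|)%N -> avg (fun _ : T => a) = a.
Proof.
move=> T0; rewrite /avg sumr_const -[a *+ _]mulr_natl mulKf //.
by rewrite pnatr_eq0 -lt0n.
Qed.

Lemma avg_le_bound T (f : T -> R) a : 0 <= a -> (forall x, f x <= a) -> avg f <= a.
Proof.
move=> a0 fa; have [T0|] := posnP #|T|; last first.
  by move=> T0; rewrite -[leRHS](avg_const a T0); apply: ler_avg.
by rewrite /avg T0 invr0 mul0r.
Qed.

Lemma avg_avgC T T' (f : T -> T' -> R) :
  avg (fun x => avg (f x)) = avg (fun y => avg (f^~ y)).
Proof.
rewrite /avg -!mulr_sumr exchange_big /=.
by rewrite !mulrA [_ * _^-1]mulrC.
Qed.

Lemma avg_pair T T' (f : T * T' -> R) :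
  avg f = avg (fun x => avg (fun y => f (x, y))).
Proof.
rewrite /avg -mulr_sumr pair_big /= card_prod natrM invfM mulrA.
by congr (_ * _); apply: eq_bigr => -[].
Qed.

Lemma avg_bij T T' (h : T -> T') (f : T' -> R) :
  bijective h -> avg (f \o h) = avg f.
Proof.
move=> bh; rewrite /avg (bij_eq_card bh); congr (_ * _).
by rewrite [RHS](reindex h) //; apply: onW_bij.
Qed.

Lemma avg_prod (S T : finType) (f : S -> T -> R) :
  avg (fun H : {ffun S -> T} => \prod_s f s (H s)) = \prod_s avg (f s).
Proof.
rewrite /avg -bigA_distr_bigA big_split /=; congr (_ * _).
by rewrite prodr_const card_ffun natrX exprVn.
Qed.

Definition merge (S T : finType) (P : pred S) (H H' : {ffun S -> T}) :=
  [ffun s => if P s then H s else H' s].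

(** Exchanging the coordinates outside [P] between [H] and [H'] is an involution on pairs that turns
    the merge into [H]. This is the device for conditioning on the coordinates in [P]. *)
Lemma avg_merge (S T : finType) (P : pred S) (F : {ffun S -> T} -> R) :
  avg (fun H => avg (fun H' => F (merge P H H'))) = avg F.
Proof.
pose sw (p : {ffun S -> T} * {ffun S -> T}) := (merge P p.1 p.2, merge P p.2 p.1).
have swK : involutive sw.
  by case=> H H'; rewrite /sw /=; congr (_, _); apply/ffunP => s; rewrite !ffunE; case: (P s).
rewrite -(avg_pair (fun p => F (merge P p.1 p.2))).
rewrite -[LHS](avg_bij _ (inv_bij swK)) avg_pair.
have [T0|T0] := posnP #|{ffun S -> T}|; first by rewrite /avg T0 !invr0 !mul0r.
apply: eq_avg => H /=; rewrite -[RHS](@avg_const {ffun S -> T}) //.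
by apply: eq_avg => H' /=; congr F; apply/ffunP => s; rewrite !ffunE; case: (P s).
Qed.

Lemma avg_sqr_le T (f : T -> R) : avg f ^+ 2 <= avg (fun x => f x ^+ 2).
Proof.
have [T0|T0] := posnP #|T|; first by rewrite /avg T0 invr0 !mul0r expr0n.
have : 0 <= avg (fun x => (f x - avg f) ^+ 2) by apply: avg_ge0 => x; exact: sqr_ge0.
rewrite (eq_avg (g := fun x => f x ^+ 2 + ((- 2 * avg f) * f x + avg f ^+ 2))); last by move=> x; ring.
rewrite avgD avgD avgMl avg_const //; lra.
Qed.

Lemma avg_ind_eq (S T : finType) (P : pred S) (a : {ffun S -> T}) :
  avg (fun H : {ffun S -> T} => [forall s, P s ==> (H s == a s)]%:R) = #|T|%:R^-1 ^+ #|P|.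
Proof.
rewrite (eq_avg (g := fun H : {ffun S -> T} => \prod_s (P s ==> (H s == a s))%:R)); last first.
  move=> H; rewrite -natr_prod; congr (_%:R).
  case: forallP => [Hs|/forallP]; first by rewrite big1 // => s _; rewrite Hs.
  by rewrite negb_forall => /existsP[s /negbTE Hs]; rewrite (bigD1 s) //= Hs.
rewrite (avg_prod (fun s x => (P s ==> (x == a s))%:R)) -prodr_const [RHS]big_mkcond /=.
apply: eq_bigr => s _; rewrite unfold_in /avg; case: (P s) => /=.
  rewrite (bigD1 (a s)) //= eqxx big1 ?addr0 ?mulr1 // => x /negbTE -> //.
rewrite sumr_const -[1 *+ _]mulr_natl mulr1 mulVf //.
by rewrite pnatr_eq0 -lt0n; apply/card_gt0P; exists (a s).
Qed.

Lemma avg_ind_card T (P : pred T) : avg (fun x => (P x)%:R) = #|P|%:R / #|T|%:R.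
Proof.
rewrite /avg mulrC; congr (_ / _).
by rewrite -natr_sum -sum1_card [in RHS]big_mkcond /=; congr (_%:R); apply: eq_bigr => x _; rewrite unfold_in; case: (P x).
Qed.

Lemma ler_ind (a b : bool) : (a -> b) -> a%:R <= b%:R :> R.
Proof. by case: a => // ->. Qed.

Definition upd (S T : finType) (H : {ffun S -> T}) s k :=
  [ffun s' => if s' == s then k else H s'].

Lemma avg_upd (S T : finType) (s : S) (F : {ffun S -> T} -> R) :
  avg (fun H => avg (fun k => F (upd H s k))) = avg F.
Proof.
pose sw (p : {ffun S -> T} * T) := (upd p.1 s p.2, p.1 s).
have swK : involutive sw.
  case=> H k; rewrite /sw /=; congr (_, _); last by rewrite ffunE eqxx.
  by apply/ffunP => s'; rewrite !ffunE; case: (s' =P s) => [->|].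
rewrite -(avg_pair (fun p => F (upd p.1 s p.2))).
rewrite -[LHS](avg_bij _ (inv_bij swK)) avg_pair.
apply: eq_avg => H /=.
have T0 : (0 < #|T|)%N by apply/card_gt0P; exists (H s).
rewrite -[RHS](@avg_const T) //.
by apply: eq_avg => k /=; congr F; apply/ffunP => s'; rewrite !ffunE; case: (s' =P s) => [->|].
Qed.

End Average.

(** * Cosine characters of Z/N *)

(** Axioms of x |-> cos (2 pi x / N). D'Alembert's functional equation takes the place of complex
    characters, so that the Fourier analysis runs in any [realFieldType]; the real cosine enters
    only at the end. *)
Definition cosine_like (R : realFieldType) (N : nat) (c : int -> R) : Prop :=
  [/\ forall x y, c (x + y) + c (x - y) = 2 * c x * c y,
      forall x, `|c x| <= 1,
      forall x, (c x == 1) = (N %| x)%Z &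
      forall x y, (N %| y)%Z -> c (x + y) = c x].

Section Cosine.
Variables (R : realFieldType) (N : nat) (c : int -> R).
Hypothesis cP : cosine_like N c.

Lemma cosD x y : c (x + y) + c (x - y) = 2 * c x * c y.
Proof. by case: cP. Qed.

Lemma cos_le1 x : c x <= 1.
Proof. by case: cP => _ h _ _; move: (h x); rewrite ler_norml => /andP[]. Qed.

Lemma cos_geN1 x : -1 <= c x.
Proof. by case: cP => _ h _ _; move: (h x); rewrite ler_norml => /andP[]. Qed.

Lemma cos_eq1 x : (c x == 1) = (N %| x)%Z.
Proof. by case: cP. Qed.

Lemma cos_periodic x y : (N %| y)%Z -> c (x + y) = c x.
Proof. by case: cP => _ _ _; apply. Qed.

Lemma cos0 : c 0 = 1.
Proof. by apply/eqP; rewrite cos_eq1 dvdz0. Qed.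

Lemma cosN x : c (- x) = c x.
Proof. by have := cosD 0 x; rewrite add0r sub0r cos0; lra. Qed.

Lemma cos_double x : c (2 * x) = 2 * c x ^+ 2 - 1.
Proof.
have := cosD x x; rewrite subrr cos0 (_ : x + x = 2 * x); last by ring.
by move=> h; rewrite expr2; lra.
Qed.

Lemma cos_triple x : c (3 * x) = 4 * c x ^+ 3 - 3 * c x.
Proof.
have := cosD (2 * x) x; rewrite cos_double.
have -> : 2 * x + x = 3 * x by ring.
have -> : 2 * x - x = x by ring.
by move=> /(canRL (addrK _)) ->; ring.
Qed.

Lemma cosB_le x y : 1 - c (x + y) <= 2 * (1 - c x) + 2 * (1 - c y).
Proof.
have := cosD x y; have := cos_le1 (x - y); have := cos_le1 x; have := cos_le1 y.
move=> h1 h2 h3 h4.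
have : 0 <= (1 - c x) * (1 - c y) by rewrite mulr_ge0 ?subr_ge0.
nra.
Qed.

(** The two sides differ by 4 (c x - 1)^2 (c x + 2). *)
Lemma cos_triple_le x : 1 - c (3 * x) <= 9 * (1 - c x).
Proof.
rewrite cos_triple.
have : 0 <= (c x - 1) ^+ 2 * (c x + 2).
  by rewrite mulr_ge0 ?sqr_ge0 //; have := cos_geN1 x; lra.
by rewrite !exprS expr0; nra.
Qed.

(* Second differences of [k |-> 1 - c (k x)] are at most [2 (1 - c x)]. *)
Lemma cos_mul_le (k : nat) x : 1 - c (k%:Z * x) <= k%:R ^+ 2 * (1 - c x).
Proof.
pose u (k : nat) := 1 - c (k%:Z * x).
have u0 : u 0%N = 0 by rewrite /u mul0r cos0 subrr.
have u1 : u 1%N = 1 - c x by rewrite /u mul1r.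
have u1_ge0 : 0 <= u 1%N by rewrite u1 subr_ge0 cos_le1.
have uS j : u j.+2 - u j.+1 <= u j.+1 - u j + 2 * u 1%N.
  have := cosD (j.+1%:Z * x) x.
  have -> : j.+1%:Z * x + x = j.+2%:Z * x by rewrite -[j.+2]addn1 PoszD; ring.
  have -> : j.+1%:Z * x - x = j%:Z * x by rewrite -[j.+1]addn1 PoszD; ring.
  have : 0 <= (1 - c x) * (1 - c (j.+1%:Z * x)).
    by rewrite mulr_ge0 // subr_ge0 cos_le1.
  by rewrite u1 /u; nra.
suff : u k <= k%:R ^+ 2 * u 1%N /\ u k.+1 - u k <= (2 * k%:R + 1) * u 1%N.
  by rewrite -u1 => -[].
elim: k => [|k [IH1 IH2]]; first by rewrite u0 subr0 expr0n /=; split; lra.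
have := uS k; rewrite -[k.+1%:R]natr1; move: IH1; rewrite !expr2; split; nra.
Qed.

Lemma sum_cos_shift (m : nat) z b : (N %| m%:Z * z)%Z ->
  \sum_(t < m) c (b + z + t%:Z * z) = \sum_(t < m) c (b + t%:Z * z).
Proof.
case: m => [|m] mz; first by rewrite !big_ord0.
rewrite big_ord_recr /= [RHS]big_ord_recl /= addrC mul0r addr0.
have -> : b + z + m%:Z * z = b + m.+1%:Z * z by rewrite -[m.+1]addn1 PoszD; ring.
rewrite cos_periodic //; congr (_ + _); apply: eq_bigr => i _; congr c.
by rewrite /bump /= PoszD; ring.
Qed.

(** Shifting the base point by [z] or by [- z] only permutes the terms, so the functional equation
    gives S + S = 2 S c(z), while c(z) is not 1. *)
Lemma sum_cos_ord (m : nat) z b : (N %| m%:Z * z)%Z -> ~~ (N %| z)%Z ->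
  \sum_(t < m) c (b + t%:Z * z) = 0.
Proof.
move=> mz Nz; set S := \sum_(t < m) _.
have E1 : \sum_(t < m) c (b + z + t%:Z * z) = S by apply: sum_cos_shift.
have E2 : \sum_(t < m) c (b - z + t%:Z * z) = S.
  by rewrite -(sum_cos_shift (b - z) mz) /S; apply: eq_bigr => t _; rewrite subrK.
have : S + S = S * (2 * c z).
  rewrite -{1}E1 -{1}E2 -big_split /S mulr_suml /=; apply: eq_bigr => t _.
  have -> : b + z + t%:Z * z = b + t%:Z * z + z by ring.
  have -> : b - z + t%:Z * z = b + t%:Z * z - z by ring.
  by rewrite cosD; ring.
move=> h; have : S * (1 - c z) = 0 by lra.
by move=> /eqP; rewrite mulf_eq0 subr_eq0 (eq_sym 1) cos_eq1 (negbTE Nz) orbF => /eqP.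
Qed.

Lemma avg_cos_ord (m : nat) z b : (0 < m)%N -> (N %| m%:Z * z)%Z ->
  avg (fun t : 'I_m => c (b + t%:Z * z)) = c b * (N %| z)%Z%:R.
Proof.
move=> m0 mz; have [Nz|Nz] := boolP (N %| z)%Z; last first.
  by rewrite /avg sum_cos_ord // !mulr0.
rewrite mulr1 -[RHS](@avg_const _ 'I_m) ?card_ord //; apply: eq_avg => t.
by rewrite cos_periodic // dvdz_mull.
Qed.

(** Independence in real form: coordinates are averaged one at a time, and the hypothesis is for
    every [b] because the remaining coordinates act as a shift. *)
Lemma avg_cos_ffun (S K : finType) (z : K -> int) (a : S -> int) (phi : S -> R) :
  (forall s b, avg (fun k => c (b + z k * a s)) = c b * phi s) ->
  forall b, avg (fun H : {ffun S -> K} => c (b + \sum_s z (H s) * a s))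
    = c b * \prod_s phi s.
Proof.
have [S0|/card_gt0P[s0 _]] := posnP #|S|.
  have e0 T (idx : T) op F : \big[op/idx]_(s : S) F s = idx.
    by rewrite big_pred0 // => s; have := card0_eq S0 s.
  move=> _ b; rewrite e0 mulr1 -[RHS](@avg_const _ {ffun S -> K}).
    by apply: eq_avg => H; rewrite e0 addr0.
  by rewrite card_ffun S0 expn0.
move=> hphi b; rewrite (eq_avg (g := fun H : {ffun S -> K} =>
  c (b + \sum_(s <- enum S) z (H s) * a s))); last by move=> H; rewrite big_enum.
rewrite -(big_enum _) /=.
have : uniq (enum S) by apply: enum_uniq.
(* [K] may be empty, and then the average is 0 as soon as [S] is not empty. Hence empty [S] was
   treated apart, and the induction starts from one-element lists. *)
have : enum S != [::] by rewrite -size_eq0 -cardE; apply/negP => /eqP/card0_eq/(_ s0).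
elim: (enum S) b => // s r IH b _ /= /andP[sr ur].
rewrite -(avg_upd s).
have e H : avg (fun k => c (b + \sum_(s1 <- s :: r) z (upd H s k s1) * a s1)) =
    c (b + \sum_(s1 <- r) z (H s1) * a s1) * phi s.
  rewrite -hphi; apply: eq_avg => k; congr c.
  rewrite big_cons ffunE eqxx [z k * _ + _]addrC addrA; congr (_ + _ + _).
  rewrite !big_seq; apply: eq_bigr => s1 s1r; rewrite ffunE.
  by case: eqP s1r sr => // -> ->.
rewrite [LHS](eq_avg e) avgMr big_cons.
have [->|r0] := eqVneq r [::]; last by rewrite IH // -mulrA [_ * phi s]mulrC.
rewrite !big_nil mulr1; have [K0|K0] := posnP #|K|.
  have -> : phi s = 0 by have := hphi s 0; rewrite cos0 mul1r /avg K0 invr0 mul0r.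
  by rewrite !mulr0.
rewrite (eq_avg (g := fun=> c b)) ?avg_const ?card_ffun ?expn_gt0 ?K0 //.
by move=> H; rewrite big_nil addr0.
Qed.

Lemma avg_char (W : finType) (r : W -> int) b : (0 < N)%N ->
  avg (fun t : {ffun W -> 'I_N} => c (b + \sum_w (t w)%:Z * r w))
    = c b * [forall w, (N %| r w)%Z]%:R.
Proof.
move=> N0.
rewrite (@avg_cos_ffun _ _ (fun t : 'I_N => t%:Z) _ (fun w => (N %| r w)%Z%:R)); last first.
  by move=> w b'; rewrite avg_cos_ord // dvdz_mulr.
rewrite -natr_prod; congr (_ * _%:R); case: forallP => [h|/forallP].
  by rewrite big1 // => w _; rewrite h.
by rewrite negb_forall => /existsP[w /negbTE hw]; rewrite (bigD1 w) //= hw.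
Qed.

End Cosine.

(** * Fourier expansion of the sign and lazy blocks *)

Definition sgn (b : bool) : int := if b then 1 else -1.

(* [lazy k], for [k] uniform in ['I_32], is [1] and [-1] with probability 1/32 each, and [0] otherwise. *)
Definition lazy (k : 'I_32) : int :=
  if k == 0%N :> nat then 1 else if k == 1%N :> nat then -1 else 0.

(** The systems h x = u and h^T y = w modulo [N], which an off-diagonal block of a symmetric matrix
    has to satisfy together. *)
Definition solves (N : nat) (I J : finType) (h : I -> J -> int)
    (x : J -> int) (u : I -> int) (y : I -> int) (w : J -> int) : bool :=
  [forall i, (N %| (\sum_j h i j * x j) - u i)%Z] &&
  [forall j, (N %| (\sum_i h i j * y i) - w j)%Z].

Lemma eq_solves N (I J : finType) (h h' : I -> J -> int) x u y w :
  (forall i j, h i j = h' i j) -> solves N h x u y w = solves N h' x u y w.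
Proof.
move=> hh; rewrite /solves; congr andb.
  by apply: eq_forallb => i; rewrite (eq_bigr _ (fun j _ => congr1 (fun h => h * x j) (hh i j))).
by apply: eq_forallb => j; rewrite (eq_bigr _ (fun i _ => congr1 (fun h => h * y i) (hh i j))).
Qed.

(** This is pi_N of the overview, with [x] the part of v on D and [y] the part off D. *)
Definition lazy_kill (R : realFieldType) (N : nat) (I J : finType)
    (y : I -> int) (x : J -> int) : R :=
  avg (fun H : {ffun I * J -> 'I_32} =>
    (solves N (fun i j => lazy (H (i, j))) x (fun=> 0) y (fun=> 0))%:R).

Section Block.
Variables (R : realFieldType) (N : nat) (c : int -> R).
Hypothesis cP : cosine_like N c.
Hypothesis N0 : (0 < N)%N.

(** The characteristic function of a random sign that is kept with probability [mu] and replaced by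
    0 otherwise. *)
Definition phi (mu : R) (a : int) : R := 1 - mu + mu * c a.

Lemma avg_cos_sgn a b : avg (fun k => c (b + sgn k * a)) = c b * c a.
Proof.
rewrite /avg card_bool big_bool /= mul1r mulN1r (cosD cP).
by rewrite -!mulrA mulKf // pnatr_eq0.
Qed.

Lemma avg_cos_lazy a b :
  avg (fun k => c (b + lazy k * a)) = c b * phi (1 / 16%:R) a.
Proof.
rewrite /avg card_ord 2!big_ord_recl /= /lazy /=.
rewrite (eq_bigr (fun=> c b)); last by move=> i _; rewrite mul0r addr0.
rewrite sumr_const card_ord !(mul1r, mulN1r).
have := cosD cP b a; rewrite /phi -[_ *+ 30]mulr_natr => h.
have -> : c (b - a) = 2 * c b * c a - c (b + a) by lra.
by field.
Qed.

Lemma sum_block (I J : finType) (h : I -> J -> int) x u y w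
    (t : I -> int) (s : J -> int) :
  \sum_i t i * ((\sum_j h i j * x j) - u i) + \sum_j s j * ((\sum_i h i j * y i) - w j)
  = - (\sum_i t i * u i + \sum_j s j * w j)
    + \sum_p h p.1 p.2 * (t p.1 * x p.2 + s p.2 * y p.1).
Proof.
rewrite -(pair_bigA _ (fun i j => h i j * (t i * x j + s j * y i))) /=.
transitivity (- (\sum_i t i * u i + \sum_j s j * w j) +
  (\sum_i \sum_j h i j * (t i * x j) + \sum_j \sum_i h i j * (s j * y i))); last first.
  congr (_ + _); rewrite [X in _ + X]exchange_big -big_split; apply: eq_bigr => i _ /=.
  by rewrite -big_split; apply: eq_bigr => j _; rewrite mulrDr.
rewrite (eq_bigr (fun i => \sum_j h i j * (t i * x j) - t i * u i)); last first.
  by move=> i _; rewrite mulrBr mulr_sumr; congr (_ - _); apply: eq_bigr => j _; ring.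
rewrite [X in _ + X](eq_bigr (fun j => \sum_i h i j * (s j * y i) - s j * w j)); last first.
  by move=> j _; rewrite mulrBr mulr_sumr; congr (_ - _); apply: eq_bigr => i _; ring.
by rewrite !sumrB; ring.
Qed.

(** Each congruence is tested by a character, [t i] for the rows and [s j] for the columns. The
    entry at (i, j) then appears once, with coefficient t_i x_j + s_j y_i, and independence of the
    entries gives the product. The right-hand sides [u] and [w] survive only in a cosine of modulus
    at most 1. *)
Lemma block_fourier (I J K : finType) (z : K -> int) (psi : int -> R) (e : I * J -> int)
    (x : J -> int) u (y : I -> int) w :
  (forall a b, avg (fun k => c (b + z k * a)) = c b * psi a) ->
  avg (fun H : {ffun I * J -> K} =>
    (solves N (fun i j => z (H (i, j)) * e (i, j)) x u y w)%:R) =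
  avg (fun t : {ffun I -> 'I_N} => avg (fun s : {ffun J -> 'I_N} =>
    c (\sum_i (t i)%:Z * u i + \sum_j (s j)%:Z * w j) *
    \prod_p psi (e p * ((t p.1)%:Z * x p.2 + (s p.2)%:Z * y p.1)))).
Proof.
move=> zP.
have solvesE h : (solves N h x u y w)%:R =
    avg (fun t : {ffun I -> 'I_N} => avg (fun s : {ffun J -> 'I_N} =>
      c (- (\sum_i (t i)%:Z * u i + \sum_j (s j)%:Z * w j)
        + \sum_p h p.1 p.2 * ((t p.1)%:Z * x p.2 + (s p.2)%:Z * y p.1)))).
  rewrite /solves -mulnb natrM.
  set A := (X in X%:R * _); set B := (X in _ * X%:R).
  transitivity (avg (fun t : {ffun I -> 'I_N} => c (0 +
    \sum_i (t i)%:Z * ((\sum_j h i j * x j) - u i)) * B%:R)).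
    by rewrite avgMr (avg_char cP) // (cos0 cP) mul1r.
  apply: eq_avg => t; rewrite -(avg_char cP) //; apply: eq_avg => s.
  by rewrite add0r sum_block.
rewrite (eq_avg (fun H => solvesE _)) avg_avgC; apply: eq_avg => t.
rewrite avg_avgC; apply: eq_avg => s.
pose a p := e p * ((t p.1)%:Z * x p.2 + (s p.2)%:Z * y p.1).
rewrite -(cosN cP) -(@avg_cos_ffun _ _ _ cP _ _ z a) //.
apply: eq_avg => H; congr c; congr (_ + _).
by apply: eq_bigr => -[i j] _ /=; rewrite mulrA.
Qed.

Lemma lazy_kill_fourier (I J : finType) (y : I -> int) (x : J -> int) :
  lazy_kill R N y x =
  avg (fun t : {ffun I -> 'I_N} => avg (fun s : {ffun J -> 'I_N} =>
    \prod_p phi (1 / 16%:R) ((t p.1)%:Z * x p.2 + (s p.2)%:Z * y p.1))).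
Proof.
rewrite /lazy_kill (eq_avg (g := fun H : {ffun I * J -> 'I_32} =>
  (solves N (fun i j => lazy (H (i, j)) * 1) x (fun=> 0) y (fun=> 0))%:R)); last first.
  by move=> H; congr (nat_of_bool _)%:R; apply: eq_solves => i j; rewrite mulr1.
rewrite (@block_fourier _ _ _ _ _ (fun=> 1) _ _ _ _ avg_cos_lazy).
apply: eq_avg => t; apply: eq_avg => s.
rewrite [X in c X](_ : _ = 0); last by rewrite !big1 ?addr0 // => ? _; rewrite mulr0.
rewrite (cos0 cP) mul1r.
by apply: eq_bigr => p _; rewrite [1 * (_ + _)]mul1r.
Qed.

(** The right-hand side is (1 + c(a)^2) / 2. Doubling the argument is the price for removing the
    sign of c(a). *)
Lemma cos_abs_le a : `|c a| <= phi (1 / 4%:R) (2 * a).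
Proof.
rewrite /phi (cos_double cP) ler_norml.
have : 0 <= (c a - 1) ^+ 2 by exact: sqr_ge0.
have : 0 <= (c a + 1) ^+ 2 by exact: sqr_ge0.
by rewrite !expr2; move=> h1 h2; apply/andP; split; lra.
Qed.

Lemma phi_le1 mu a : 0 <= mu -> phi mu a <= 1.
Proof. by move=> mu0; have := cos_le1 cP a; rewrite /phi; nra. Qed.

Lemma phi_ge0 mu a : 0 <= mu -> mu <= 1 / 2%:R -> 0 <= phi mu a.
Proof. by move=> mu0; have := cos_geN1 cP a; rewrite /phi; nra. Qed.

Lemma phi_anti mu nu a : mu <= nu -> phi nu a <= phi mu a.
Proof. by move=> mu0; have := cos_le1 cP a; rewrite /phi; nra. Qed.

(** With X = 1 - c(a) and Y = 1 - c(b), both in [0, 2], [cosB_le] reduces this to X Y <= 2 (X + Y).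
    The passage from 1/4 to 1/16 is what separates the row characters from the column characters. *)
Lemma phi_mul_le a b :
  phi (1 / 4%:R) a * phi (1 / 4%:R) b <= phi (1 / 16%:R) (a + b).
Proof.
rewrite /phi; have := cosB_le cP a b; have := cos_le1 cP a; have := cos_le1 cP b.
have := cos_geN1 cP a; have := cos_geN1 cP b; nra.
Qed.

(** Tripling costs a factor 9 in the laziness, which is the origin of 1/144 in [typical]. *)
Lemma phi_triple a : phi (1 / 16%:R) a <= phi (1 / 144%:R) (3 * a).
Proof. by rewrite /phi; have := cos_triple_le cP a; lra. Qed.

Lemma phi_periodic mu x y : (N %| y)%Z -> phi mu (x + y) = phi mu x.
Proof. by move=> Ny; rewrite /phi (cos_periodic cP). Qed.

End Block.

(** * Comparison of sign sums and sign blocks with lazy blocks *)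

Section SmallBall.
Variables (R : realFieldType) (N : nat) (c : int -> R).
Hypothesis cP : cosine_like N c.
Hypothesis N_odd : odd N.

Let N0 : (0 < N)%N. Proof. by case: N N_odd. Qed.

Let cop2 : coprimez N 2.
Proof. by rewrite coprimezE /= coprimen2. Qed.

(** 2 is invertible modulo an odd [N]; this absorbs the doubled arguments produced by
    [cos_abs_le]. *)
Lemma lazy_kill_double (I J : finType) (y : I -> int) (x : J -> int) :
  lazy_kill R N (fun i => 2 * y i) (fun j => 2 * x j) = lazy_kill R N y x.
Proof.
have dbl (T : finType) (h v : T -> int) :
    (N %| \sum_i h i * (2 * v i) - 0)%Z = (N %| \sum_i h i * v i - 0)%Z.
  rewrite !subr0 -(Gauss_dvdzr (\sum_i h i * v i) cop2) mulr_sumr.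
  by rewrite (eq_bigr (fun i => 2 * (h i * v i))) // => i _; ring.
by apply: eq_avg => H; congr (nat_of_bool _)%:R; congr andb;
  apply: eq_forallb => i; apply: dbl.
Qed.

(** Taking absolute values in the Fourier expansion removes [u], [w] and the signs [e], and turns
    every cosine into a nonnegative lazy factor. The bound is thus uniform in the right-hand
    sides. *)
Lemma sign_block_le (I J : finType) (e : I * J -> int)
    (x : J -> int) u (y : I -> int) w :
  (forall p, (e p == 1) || (e p == -1)) ->
  avg (fun H : {ffun I * J -> bool} =>
    (solves N (fun i j => sgn (H (i, j)) * e (i, j)) x u y w)%:R) <= lazy_kill R N y x.
Proof.
move=> e1; rewrite (block_fourier cP N0 _ _ _ _ _ (avg_cos_sgn cP)).
rewrite -lazy_kill_double (lazy_kill_fourier cP N0).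
apply: ler_avg => t; apply: ler_avg => s.
apply: le_trans (ler_norm _) _; rewrite normrM.
apply: le_trans (ler_piMl (normr_ge0 _) _) _; first by case: cP.
rewrite normr_prod; apply: ler_prod => p _; rewrite normr_ge0 /=.
rewrite (_ : c _ = c ((t p.1)%:Z * x p.2 + (s p.2)%:Z * y p.1)); last first.
  by case/orP: (e1 p) => /eqP ->; rewrite ?mul1r // mulN1r (cosN cP).
apply: le_trans (cos_abs_le cP _) _.
rewrite (_ : 2 * _ = (t p.1)%:Z * (2 * x p.2) + (s p.2)%:Z * (2 * y p.1)); last by ring.
by apply: (phi_anti cP); lra.
Qed.

Lemma sign_sum_le (W J : finType) (g : J -> W) (v : W -> int) a : injective g ->
  avg (fun e : {ffun W -> bool} => (N %| (\sum_w sgn (e w) * v w) - a)%Z%:R) <=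
  avg (fun t : 'I_N => \prod_j phi c (1 / 4%:R) (t%:Z * (2 * v (g j)))).
Proof.
move=> g_inj.
rewrite (eq_avg (g := fun e : {ffun W -> bool} => avg (fun t : 'I_N =>
    c (- (t%:Z * a) + \sum_w sgn (e w) * (t%:Z * v w))))); last first.
  move=> e; rewrite -[LHS]mul1r -{1}(cos0 cP) -(@avg_cos_ord _ _ _ cP N) //; last by rewrite dvdz_mulr.
  apply: eq_avg => t; congr c; rewrite add0r mulrBr addrC mulr_sumr; congr (_ + _).
  by apply: eq_bigr => w _; rewrite mulrCA.
rewrite avg_avgC; apply: ler_avg => t.
rewrite (@avg_cos_ffun _ _ _ cP _ _ sgn (fun w => t%:Z * v w) (fun w => c (t%:Z * v w))); last first.
  by move=> w b; rewrite (avg_cos_sgn cP).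
have c1 z : `|c z| <= 1 by case: cP.
apply: le_trans (ler_norm _) _; rewrite normrM.
apply: le_trans (ler_piMl (normr_ge0 _) (c1 _)) _.
rewrite normr_prod (bigID [pred w | w \in [set g j | j in J]]) /=.
apply: le_trans (ler_piMr _ _) _; first by apply: prodr_ge0.
  by apply: prodr_ile1 => w _; rewrite normr_ge0 c1.
rewrite big_imset /=; last by move=> ? ? _ _; apply: g_inj.
apply: ler_prod => j _; rewrite normr_ge0 /=.
by rewrite mulrCA; apply: (cos_abs_le cP).
Qed.

(** In the Fourier expansion [phi_mul_le] bounds each factor below by a function of [t i] times a
    function of [s j], after which the average splits over the coordinates of t and of s. *)
Lemma lazy_kill_ge (I J : finType) (y : I -> int) (x : J -> int) :
  (avg (fun t : 'I_N => \prod_j phi c (1 / 4%:R) (t%:Z * (2 * x j)))) ^+ #|I| *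
  (avg (fun t : 'I_N => \prod_i phi c (1 / 4%:R) (t%:Z * (2 * y i)))) ^+ #|J|
  <= lazy_kill R N y x.
Proof.
rewrite -lazy_kill_double (lazy_kill_fourier cP N0).
rewrite -!prodr_const -!avg_prod -avgMl.
apply: le_trans (_ : avg (fun s : {ffun J -> 'I_N} => avg (fun t : {ffun I -> 'I_N} =>
   (\prod_i \prod_j phi c (1 / 4%:R) ((t i)%:Z * (2 * x j))) *
   (\prod_j \prod_i phi c (1 / 4%:R) ((s j)%:Z * (2 * y i))))) <= _).
  by rewrite le_eqVlt; apply/orP; left; apply/eqP/eq_avg => s; rewrite avgMr.
rewrite avg_avgC; apply: ler_avg => t; apply: ler_avg => s.
rewrite [X in _ * X]exchange_big !pair_big -big_split /=.
apply: ler_prod => p _; rewrite (phi_mul_le cP) andbT.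
by rewrite mulr_ge0 // (phi_ge0 cP) //; lra.
Qed.

(** The powers are distributed crosswise: the atom bound through the coordinates in [J] is used #|I|
    times, and the one through [I] is used #|J| times. *)
Lemma sign_sum_pow_le (W I J : finType) (f : I -> W) (g : J -> W) (v : W -> int) a :
  injective f -> injective g ->
  avg (fun e : {ffun W -> bool} => (N %| (\sum_w sgn (e w) * v w) - a)%Z%:R) ^+ (#|I| + #|J|)
  <= lazy_kill R N (v \o f) (v \o g).
Proof.
move=> f_inj g_inj; apply: le_trans (lazy_kill_ge _ _).
have rho0 : 0 <= avg (fun e : {ffun W -> bool} => (N %| (\sum_w sgn (e w) * v w) - a)%Z%:R : R).
  by apply: avg_ge0 => e; rewrite ler0n.
rewrite exprD; apply: ler_pM; rewrite ?exprn_ge0 //.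
  exact: lerXn2r (rho0) (le_trans rho0 (sign_sum_le _ _ g_inj)) (sign_sum_le _ _ g_inj).
exact: lerXn2r (rho0) (le_trans rho0 (sign_sum_le _ _ f_inj)) (sign_sum_le _ _ f_inj).
Qed.

End SmallBall.

(** * Lazy rows confined to a proper subspace modulo 3 *)

Definition typical (R : realFieldType) (N : nat) (c : int -> R) (J : finType)
    (x : J -> int) (tau : R) : Prop :=
  forall t : int, ~~ (N %| t)%Z -> \prod_j phi c (1 / 144%:R) (t * x j) <= tau.

Section Conditioned.
Variables (R : realFieldType) (N' : nat) (c : int -> R).
Let N := (3 * N')%N.
Hypothesis cP : cosine_like N c.
Hypothesis N'_gt0 : (0 < N')%N.

Let N0 : (0 < N)%N. Proof. by rewrite muln_gt0. Qed.

Let dvd3 (r : int) : (N %| N'%:Z * r)%Z = (3 %| r)%Z.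
Proof. by rewrite /N PoszM [N'%:Z * r]mulrC dvdz_mul2r // eqz_nat -lt0n. Qed.

Let dvd3l (r : int) : (N %| 3%:Z * r)%Z = (N' %| r)%Z.
Proof. by rewrite /N PoszM dvdz_mul2l. Qed.

Lemma avg_char3 (W : finType) (r : W -> int) b :
  avg (fun t : {ffun W -> 'I_3} => c (b + \sum_w (t w)%:Z * (N'%:Z * r w)))
    = c b * [forall w, (3 %| r w)%Z]%:R.
Proof.
rewrite (@avg_cos_ffun _ _ _ cP _ _ (fun t : 'I_3 => t%:Z) _ (fun w => (3 %| r w)%Z%:R)); last first.
  move=> w b'; rewrite (avg_cos_ord cP) ?dvd3 //.
  by rewrite mulrCA dvd3 dvdz_mulr.
rewrite -natr_prod; congr (_ * _%:R); case: forallP => [h|/forallP].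
  by rewrite big1 // => w _; rewrite h.
by rewrite negb_forall => /existsP[w /negbTE hw]; rewrite (bigD1 w) //= hw.
Qed.

Lemma avg_dvd_triple : avg (fun t : 'I_N => (N %| 3%:Z * t%:Z)%Z%:R) <= 3%:R / N%:R :> R.
Proof.
rewrite avg_ind_card card_ord ler_pM2r ?invr_gt0 ?ltr0n // ler_nat.
rewrite -[leqRHS]card_ord; set A := (X in (#|X| <= _)%N).
have dA (t : 'I_N) : t \in A -> (N' %| t)%N by rewrite unfold_in /A /= dvd3l.
pose g (t : 'I_N) : 'I_3 := inord (t %/ N').
rewrite -[leqLHS](card_in_imset (f := g)) ?max_card // => t t' /dA tA /dA tA' /(congr1 (@nat_of_ord 3)).
have lt3 (s : 'I_N) : (s %/ N' < 3)%N by rewrite ltn_divLR // (leq_trans (ltn_ord s)).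
rewrite /g !inordK ?lt3 // => E; apply: val_inj.
by rewrite /= -(divnK tA) -(divnK tA') E.
Qed.

(** The two copies of [x] are tested by characters t modulo [N], and the constraints modulo 3 by
    characters s, which enter as multiples of [N']. If 3 t is not 0 modulo [N], tripling erases s
    and typicality gives [tau]. The remaining t have frequency at most 9 / N^2, and for them each
    pivot [f q] sees only its own [s q], whose average is 15/16. *)
Lemma lazy_row_dual_le (J C : finType) (x : J -> int) (tau : R)
    (B : bool * J -> C -> int) (f : C -> bool * J) :
  typical N c x tau -> injective f ->
  (forall p q, B (f p) q = (p == q)%:R) ->
  avg (fun h : {ffun bool * J -> 'I_32} =>
    ([forall b, (N %| \sum_j lazy (h (b, j)) * x j)%Z] &&
     [forall q, (3 %| \sum_l lazy (h l) * B l q)%Z])%:R)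
  <= 9%:R / N%:R ^+ 2 * (15%:R / 16%:R) ^+ #|C| + tau.
Proof.
move=> typ f_inj Bf.
pose a (t : {ffun bool -> 'I_N}) (s : {ffun C -> 'I_3}) (l : bool * J) : int :=
  (t l.1)%:Z * x l.2 + N'%:Z * \sum_q (s q)%:Z * B l q.
rewrite (eq_avg (g := fun h : {ffun bool * J -> 'I_32} =>
    avg (fun t : {ffun bool -> 'I_N} => avg (fun s : {ffun C -> 'I_3} =>
      c (0 + \sum_l lazy (h l) * a t s l))))); last first.
  move=> h; rewrite -mulnb natrM -[[forall b, _]%:R]mul1r -{1}(cos0 cP).
  rewrite -(avg_char cP) // -avgMr; apply: eq_avg => t.
  rewrite -avg_char3; apply: eq_avg => s; congr c; rewrite !add0r.
  transitivity (\sum_l (lazy (h l) * ((t l.1)%:Z * x l.2) +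
     lazy (h l) * (N'%:Z * \sum_q (s q)%:Z * B l q))); last first.
    by apply: eq_bigr => l _; rewrite -mulrDr.
  rewrite big_split big_pairE /=.
  congr (_ + _).
    by apply: eq_bigr => b _; rewrite mulr_sumr; apply: eq_bigr => j _; ring.
  rewrite [RHS](eq_bigr (fun l => \sum_q (s q)%:Z * (N'%:Z * (lazy (h l) * B l q)))).
    by rewrite exchange_big; apply: eq_bigr => q _; rewrite !mulr_sumr.
  by move=> l _; rewrite !mulr_sumr; apply: eq_bigr => q _; ring.
rewrite avg_avgC.
(* Here [bad] singles out the characters that tripling annihilates, for which typicality says
   nothing. *)
pose bad (t : {ffun bool -> 'I_N}) := [forall b, (N %| 3%:Z * (t b)%:Z)%Z].
have tau0 : 0 <= tau.
  apply: le_trans (typ 1 _).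
    by apply: prodr_ge0 => j _; rewrite (phi_ge0 cP) //; lra.
  by rewrite dvdz1 /N; case: (N') N'_gt0 => // n _; rewrite mulnS.
have phi01 l : 0 <= phi c (1 / 16%:R) l <= 1.
  by rewrite (phi_ge0 cP) ?(phi_le1 cP) //; lra.
apply: le_trans (_ : avg (fun t => (bad t)%:R * (15%:R / 16%:R) ^+ #|C| + tau) <= _); last first.
  rewrite avgD avgMr avg_const ?card_ffun ?card_ord ?expn_gt0 ?N0 //.
  rewrite lerD2r; apply: ler_wpM2r; first by rewrite exprn_ge0 // divr_ge0.
  rewrite (eq_avg (g := fun t : {ffun bool -> 'I_N} =>
     \prod_b (N %| 3%:Z * (t b)%:Z)%Z%:R)); last first.
    move=> t; rewrite -natr_prod; congr (_%:R); rewrite /bad; case: forallP => [h|/forallP].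
      by rewrite big1 // => b _; rewrite h.
    by rewrite negb_forall => /existsP[w /negbTE hw]; rewrite (bigD1 w) //= hw.
  rewrite (avg_prod (fun _ (t : 'I_N) => (N %| 3%:Z * t%:Z)%Z%:R)) prodr_const card_bool.
  apply: le_trans (lerXn2r 2 _ _ avg_dvd_triple) _; rewrite ?nnegrE ?avg_ge0 //.
    by rewrite divr_ge0.
  by rewrite expr_div_n -[3%:R ^+ 2]natrX lexx.
apply: ler_avg => t.
rewrite avg_avgC (eq_avg (g := fun s => \prod_l phi c (1 / 16%:R) (a t s l))); last first.
  move=> s; rewrite (@avg_cos_ffun _ _ _ cP _ _ lazy (a t s) (fun l => phi c (1 / 16%:R) (a t s l))).
    by rewrite (cos0 cP) mul1r.
  by move=> l b; rewrite (avg_cos_lazy cP).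
case: (boolP (bad t)) => [/forallP tbad|]; last first.
  rewrite /bad negb_forall => /existsP[b tb]; rewrite mul0r add0r.
  apply: avg_le_bound => // s; apply: le_trans (typ _ tb).
  rewrite big_pairE (bigD1 b) //=.
  apply: le_trans (ler_piMr _ _) _.
  - by apply: prodr_ge0 => j _; case/andP: (phi01 (a t s (b, j))).
  - apply: prodr_ile1 => b' _; apply/andP; split.
      by apply: prodr_ge0 => j _; case/andP: (phi01 (a t s (b', j))).
    by apply: prodr_ile1 => j _; apply: phi01.
  apply: ler_prod => j _; case/andP: (phi01 (a t s (b, j))) => -> _ /=.
  apply: le_trans (phi_triple cP _) _; rewrite le_eqVlt; apply/orP; left; apply/eqP.
  rewrite /a /= mulrDr mulrA (phi_periodic cP) // mulrA.
  by rewrite /N PoszM dvdz_mulr.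
rewrite [true%:R * _]mul1r; apply: le_trans (_ : (15%:R / 16%:R) ^+ #|C| <= _); last by rewrite lerDl.
pose u q := ((t (f q).1)%:Z %/ N')%Z * x (f q).2.
have af s q : a t s (f q) = N'%:Z * u q + (s q)%:Z * N'%:Z.
  have /dvdzP[r tr] : (N' %| (t (f q).1)%:Z)%Z by rewrite -dvd3l.
  rewrite /a /u tr mulzK ?eqz_nat -?lt0n // (bigD1 q) //= Bf eqxx big1 ?addr0; first by rewrite [_ * true%:R]mulr1; ring.
  by move=> q' /negbTE qq'; rewrite Bf eq_sym qq' mulr0.
(* Only the factors at the pivots are kept, since the others are at most 1; what is left is
   independent over [q]. *)
apply: le_trans (_ : avg (fun s : {ffun C -> 'I_3} =>
   \prod_q phi c (1 / 16%:R) (N'%:Z * u q + (s q)%:Z * N'%:Z)) <= _).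
  apply: ler_avg => s; rewrite (bigID [pred l | l \in [set f q | q in C]]) /=.
  apply: le_trans (ler_piMr _ _) _.
  - by apply: prodr_ge0 => l _; case/andP: (phi01 (a t s l)).
  - by apply: prodr_ile1 => l _; apply: phi01.
  rewrite big_imset /=; last by move=> ? ? _ _; apply: f_inj.
  by apply: ler_prod => q _; rewrite -af lexx andbT; case/andP: (phi01 (a t s (f q))).
rewrite (avg_prod (fun q (s : 'I_3) => phi c (1 / 16%:R) (N'%:Z * u q + s%:Z * N'%:Z))).
rewrite -prodr_const; apply: ler_prod => q _; rewrite avg_ge0 => [/=|s]; last first.
  by case/andP: (phi01 (N'%:Z * u q + s%:Z * N'%:Z)).
rewrite /phi avgD avgMl (avg_cos_ord cP) ?avg_const ?card_ord //.
have -> : (N %| N'%:Z)%Z = false by rewrite -[N'%:Z]mulr1 dvd3.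
by rewrite !mulr0; lra.
Qed.

End Conditioned.

(** * Ranks modulo 3 and the second moment *)

Lemma dvd3_F3 (r : int) : (3 %| r)%Z = (r%:~R == 0 :> 'F_3).
Proof. by rewrite -(dvdz_pcharf (R := 'F_3) (p := 3)) // pchar_Fp. Qed.

(** A basis of the kernel has an invertible minor, and multiplying by its inverse turns that minor
    into the identity. The pivots [f] are what makes the dual constraints independent in
    [lazy_row_dual_le]. *)
Lemma kernel_pivots (F : fieldType) (r m : nat) (M : 'M[F]_(r, m)) :
  exists (k : nat) (B : 'M[F]_(m, k)) (f : 'I_k -> 'I_m),
    [/\ (\rank M + k = m)%N, injective f, M *m B = 0 &
        forall p q, B (f p) q = (p == q)%:R].
Proof.
pose K := kermx M^T; pose Bt := row_base K.
have kE : (\rank M + \rank K = m)%N.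
  by rewrite mxrank_ker mxrank_tr subnKC // rank_leq_col.
have full : row_full Bt^T.
  by rewrite /row_full mxrank_tr; apply: row_base_free.
pose f := fullrankfun full; pose D := rowsub f Bt^T.
have Du : D \in unitmx by apply: fullrowsub_unit.
have MB : M *m Bt^T = 0.
  apply: trmx_inj; rewrite trmx_mul trmxK trmx0; apply/sub_kermxP.
  by rewrite /Bt eq_row_base.
exists (\rank K), (Bt^T *m invmx D), f; split => //.
- exact: fullrankfun_inj.
- by rewrite mulmxA MB mul0mx.
- move=> p q; have : rowsub f (Bt^T *m invmx D) = 1%:M.
    by rewrite -mul_rowsub_mx mulmxV.
  by move/matrixP/(_ p q); rewrite !mxE.
Qed.

Section Rows.
Variables (I L : finType).
Implicit Types (H : I -> L -> int) (A : {set I}).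

Definition row_mod3 (h : L -> int) : 'rV['F_3]_#|L| := \row_l (h (enum_val l))%:~R.

Definition rows_mod3 A H : 'M['F_3]_(#|A|, #|L|) :=
  \matrix_(a < #|A|) row_mod3 (H (enum_val a)).

Lemma exists_basis_rows H : exists A,
  row_free (rows_mod3 A H) /\ forall i, (row_mod3 (H i) <= rows_mod3 A H)%MS.
Proof.
pose M : 'M['F_3]_(#|I|, #|L|) := \matrix_a row_mod3 (H (enum_val a)).
pose f := maxrankfun M; pose A := [set enum_val (f k) | k : 'I_(\rank M)].
have rowA i : i \in A -> (row_mod3 (H i) <= rows_mod3 A H)%MS.
  move=> iA; rewrite (_ : row_mod3 _ = row (enum_rank_in iA i) (rows_mod3 A H)) ?row_sub //.
  by rewrite rowK enum_rankK_in.
have MA : (M <= rows_mod3 A H)%MS.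
  rewrite -(eq_maxrowsub M); apply/row_subP => k.
  by rewrite row_rowsub rowK rowA //; apply: imset_f.
have cA : #|A| = \rank M.
  by rewrite card_imset ?card_ord // => k k' /enum_val_inj/maxrankfun_inj.
exists A; split; last first.
  move=> i; apply: submx_trans MA; rewrite (_ : row_mod3 _ = row (enum_rank i) M) ?row_sub //.
  by rewrite rowK enum_rankK.
by rewrite /row_free eqn_leq rank_leq_row /= [leqLHS]cA mxrankS.
Qed.

Lemma row_free_dvd3 A H (z : I -> int) : row_free (rows_mod3 A H) ->
  (forall l, (3 %| \sum_(i in A) z i * H i l)%Z) -> forall i, i \in A -> (3 %| z i)%Z.
Proof.
move=> Afree zH i iA; pose u : 'rV['F_3]_#|A| := \row_a (z (enum_val a))%:~R.
have : u *m rows_mod3 A H == 0.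
  apply/eqP/rowP => l; rewrite !mxE.
  have := zH (enum_val l); rewrite dvd3_F3 => /eqP z0; rewrite -[RHS]z0.
  rewrite [in RHS]big_enum_val /= rmorph_sum; apply: eq_bigr => a _.
  by rewrite !mxE rmorphM.
rewrite mulmx_free_eq0 // => /eqP/rowP/(_ (enum_rank_in iA i)).
by rewrite !mxE enum_rankK_in // dvd3_F3 => ->.
Qed.

(** Independence over the field gives divisibility by 3; dividing all the coefficients by 3 then
    lowers the exponent by one. *)
Lemma row_free_dvd3X A H (j : nat) (z : I -> int) : row_free (rows_mod3 A H) ->
  (forall l, ((3 ^ j)%N %| \sum_(i in A) z i * H i l)%Z) ->
  forall i, i \in A -> ((3 ^ j)%N %| z i)%Z.
Proof.
move=> Afree; elim: j z => [|j IH] z zH i iA; first by rewrite expn0 dvd1z.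
have z3 i' : i' \in A -> (3 %| z i')%Z.
  apply: row_free_dvd3 Afree _ i' => l; apply: dvdz_trans (zH l).
  by rewrite expnS PoszM dvdz_mulr.
have -> : z i = 3%:Z * (z i %/ 3)%Z by rewrite mulrC divzK // z3.
rewrite expnS PoszM dvdz_mul2l //; apply: (IH (fun i => (z i %/ 3)%Z)) => // l.
have := zH l; rewrite expnS PoszM (eq_bigr (fun i' => 3%:Z * ((z i' %/ 3)%Z * H i' l))).
  by rewrite -mulr_sumr dvdz_mul2l.
by move=> i' i'A; rewrite mulrA [3%:Z * _]mulrC divzK // z3.
Qed.

(** Freeze the coordinates outside [A]. Two solutions then differ by a combination of the
    independent rows in [A], so they agree: at most one choice of the coordinates in [A] is left. *)
Lemma avg_solutions_le (R : realFieldType) A H (j : nat) : row_free (rows_mod3 A H) ->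
  avg (fun y : {ffun I -> 'I_(3 ^ j)} =>
    [forall l, ((3 ^ j)%N %| \sum_i H i l * (y i)%:Z)%Z]%:R : R) <= (3 ^ j)%:R^-1 ^+ #|A|.
Proof.
move=> Afree; set N := (3 ^ j)%N.
have N0 : (0 < N)%N by rewrite expn_gt0.
have iN0 : 0 <= N%:R^-1 ^+ #|A| :> R by rewrite exprn_ge0 // invr_ge0 ler0n.
rewrite -(avg_merge (mem A)) avg_avgC; apply: avg_le_bound => // yo.
pose sol (y : {ffun I -> 'I_N}) := [forall l, (N %| \sum_i H i l * (merge (mem A) y yo i)%:Z)%Z].
have [/existsP[y1 s1]|] := boolP [exists y, sol y]; last first.
  rewrite negb_exists => /forallP ns; apply: avg_le_bound => // y.
  by rewrite [X in (nat_of_bool X)%:R](negbTE (ns y)).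
have <- : #|mem A| = #|A| by [].
rewrite -[N in N%:R]card_ord -(avg_ind_eq _ _ y1); apply: ler_avg => y; apply: ler_ind => s.
apply/forallP => i; apply/implyP => iA; apply/eqP/val_inj => /=.
have : (N %| (y i)%:Z - (y1 i)%:Z)%Z.
  apply: (row_free_dvd3X (z := fun i => (y i)%:Z - (y1 i)%:Z) Afree) => // l.
  have := rpredB (forallP s l) (forallP s1 l).
  rewrite -sumrB [X in (_ %| X)%Z -> _](bigID (mem A)) /= [X in _ + X]big1 ?addr0; last first.
    by move=> i' /negbTE i'A; rewrite !ffunE /= i'A subrr.
  rewrite (eq_bigr (fun i => ((y i)%:Z - (y1 i)%:Z) * H i l)) // => i' i'A.
  by rewrite !ffunE /= i'A; ring.
by rewrite -eqz_mod_dvd !modz_nat eqz_nat !modn_small // => /eqP.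
Qed.
End Rows.

Section SecondMoment.
Variables (R : realFieldType) (j0 : nat) (c : int -> R).
Let N := (3 ^ j0.+1)%N.
Hypothesis cP : cosine_like N c.
Variables (I J : finType) (x : J -> int) (tau : R).
Hypothesis typ : typical N c x tau.
Local Notation L := (bool * J)%type.
Local Notation row := {ffun L -> 'I_32}.
Local Notation al := (15%:R / 16%:R : R).
Implicit Types (G : {ffun I -> row}) (h : row) (A : {set I}).

Let N0 : (0 < N)%N. Proof. by rewrite expn_gt0. Qed.
Let Nr0 : 0 < N%:R :> R. Proof. by rewrite ltr0n. Qed.

Let lz G : I -> L -> int := fun i l => lazy (G i l).

Definition kills h := [forall b, (N %| \sum_j lazy (h (b, j)) * x j)%Z].

Definition rows_le A G h := (row_mod3 (lazy \o h) <= rows_mod3 A (lz G))%MS.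

(** A row in the span is orthogonal to the pivoted kernel basis, which has at least #|L| - #|A|
    columns. *)
Lemma lazy_row_span_le A G :
  avg (fun h => (kills h && rows_le A G h)%:R) <=
  9%:R / N%:R ^+ 2 * al ^+ (#|{: bool * J}| - #|A|) + tau.
Proof.
have [k [B [f [rk f_inj MB Bf]]]] := kernel_pivots (rows_mod3 A (lz G)).
pose Bz (l : L) q : int := (B (enum_rank l) q : nat)%:Z.
pose fz q : L := enum_val (f q).
have N3 : N = (3 * 3 ^ j0)%N by rewrite /N expnS.
have fz_inj : injective fz by move=> p q /enum_val_inj/f_inj.
have Bzf p q : Bz (fz p) q = (p == q)%:R by rewrite /Bz /fz enum_valK Bf; case: eqP.
have g0 : (0 < 3 ^ j0)%N by rewrite expn_gt0.
have cP' : cosine_like (3 * 3 ^ j0) c by rewrite -N3.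
have typ' : typical (3 * 3 ^ j0) c x tau by rewrite -N3.
apply: le_trans (le_trans _ (lazy_row_dual_le cP' g0 typ' fz_inj Bzf)) _.
  rewrite -N3; apply: ler_avg => h; apply: ler_ind => /andP[kh]; rewrite /rows_le => /submxP[D hD].
  apply/andP; split => //; apply/forallP => q.
  have /rowP/(_ q) : row_mod3 (lazy \o h) *m B = 0 by rewrite hD -mulmxA MB mulmx0.
  rewrite !mxE dvd3_F3 => E; apply/eqP; rewrite -[RHS]E rmorph_sum.
  rewrite [RHS](reindex enum_rank) /=; last by apply: onW_bij; exact: enum_rank_bij.
  apply: eq_bigr => l _; rewrite !mxE enum_rankK rmorphM /Bz /=; congr (_ * _).
  by rewrite -[RHS]natr_Zp pmulrn.
rewrite -N3 lerD2r; apply: ler_wpM2l; first by rewrite divr_ge0 ?exprn_ge0 ?ler0n.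
rewrite card_ord ler_wiXn2l ?divr_ge0 ?ler0n //; first by lra.
by rewrite leq_subLR -{1}rk leq_add2r rank_leq_row.
Qed.

Lemma lazy_row_le : avg (fun h => (kills h)%:R) <= 9%:R / N%:R ^+ 2 + tau.
Proof.
have N3 : N = (3 * 3 ^ j0)%N by rewrite /N expnS.
have g0 : (0 < 3 ^ j0)%N by rewrite expn_gt0.
have cP' : cosine_like (3 * 3 ^ j0) c by rewrite -N3.
have typ' : typical (3 * 3 ^ j0) c x tau by rewrite -N3.
pose f (q : 'I_0) : L := False_rect _ (notF (valP q)).
have f_inj : injective f by case.
pose B (_ : L) (_ : 'I_0) : int := 0.
have Bf p q : B (f p) q = (p == q)%:R by case: p.
have := lazy_row_dual_le cP' g0 typ' f_inj Bf.
rewrite card_ord expr0 mulr1 -N3; apply: le_trans; apply: ler_avg => h; apply: ler_ind => kh.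
by apply/andP; split => //; apply/forallP; case.
Qed.

(** The span condition involves only the rows in [A]. With these fixed, the rows outside [A] are
    independent and each must fall into the fixed span. *)
Lemma avg_kills_span_le A : 0 <= tau ->
  avg (fun G => [forall i, kills (G i) && ((i \in A) || rows_le A G (G i))]%:R) <=
  (9%:R / N%:R ^+ 2 + tau) ^+ #|A| *
  (9%:R / N%:R ^+ 2 * al ^+ (#|{: bool * J}| - #|A|) + tau) ^+ #|~: A|.
Proof.
move=> tau0; rewrite -(avg_merge (mem A)).
set b0 := 9%:R / _ + tau; set b1 := _ * _ + tau.
have b1_ge0 : 0 <= b1.
  by rewrite addr_ge0 // mulr_ge0 ?divr_ge0 ?exprn_ge0 ?divr_ge0 ?ler0n.
pose F0 i h : R := if i \in A then (kills h)%:R else 1.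
pose F1 G i h : R := if i \in A then 1 else (kills h && rows_le A G h)%:R.
have step G G' : [forall i, kills (merge (mem A) G G' i) &&
      ((i \in A) || rows_le A (merge (mem A) G G') (merge (mem A) G G' i))]%:R <=
    (\prod_i F0 i (G i)) * (\prod_i F1 G i (G' i)).
  have rE h : rows_le A (merge (mem A) G G') h = rows_le A G h.
    congr (_ <= _)%MS; apply/row_matrixP => a; rewrite !rowK.
    by apply/rowP => l; rewrite !mxE /lz ffunE /= enum_valP.
  rewrite -big_split /= /F0 /F1.
  case: forallP => [H|_]; last by rewrite prodr_ge0 // => i _; case: ifP; rewrite mulr_ge0 ?ler0n.
  rewrite big1 // => i _; move: (H i); rewrite rE ffunE /=.
  by case: ifP => _ /= /andP[-> r1]; rewrite ?r1 ?mulr1 ?mul1r.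
apply: le_trans (ler_avg (fun G => ler_avg (step G))) _.
rewrite (eq_avg (g := fun G => (\prod_i F0 i (G i)) * avg (fun G' : {ffun I -> row} => \prod_i F1 G i (G' i)))); last first.
  by move=> G; rewrite avgMl.
apply: le_trans (_ : avg (fun G : {ffun I -> row} => (\prod_i F0 i (G i)) * b1 ^+ #|~: A|) <= _).
  apply: ler_avg => G; apply: ler_wpM2l.
    by apply: prodr_ge0 => i _; rewrite /F0; case: ifP.
  rewrite avg_prod (bigID (mem A)) /= big1 ?mul1r => [|i iA]; last first.
    by rewrite /F1 iA avg_const // card_ffun card_ord expn_gt0.
  rewrite -prodr_const [leRHS](eq_bigl [pred i | i \notin A]) /=; last by move=> i; rewrite !inE.
  apply: ler_prod => i /negbTE iA; rewrite /F1 iA lazy_row_span_le andbT.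
  by apply: avg_ge0 => h; rewrite ler0n.
rewrite avgMr avg_prod; apply: ler_wpM2r; first by rewrite exprn_ge0.
rewrite (bigID (mem A)) /= [X in _ * X]big1 ?mulr1 => [|i /negbTE iA]; last first.
  by rewrite /F0 iA avg_const // card_ffun card_ord expn_gt0.
rewrite -prodr_const; apply: ler_prod => i iA; rewrite /F0 iA lazy_row_le andbT.
by apply: avg_ge0 => h; rewrite ler0n.
Qed.

(** The square is the probability that two independent blocks both solve the systems for the same
    [y]; they are packed into one array whose rows are indexed by [bool * J]. *)
Lemma lazy_kill_sqrE (y : I -> int) :
  lazy_kill R N y x ^+ 2 =
  avg (fun G => [forall i, kills (G i)]%:R *
    [forall l, (N %| \sum_i lz G i l * y i)%Z]%:R).
Proof.
pose cv (G : {ffun I -> row}) : {ffun I * J -> 'I_32} * {ffun I * J -> 'I_32} :=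
  ([ffun p => G p.1 (true, p.2)], [ffun p => G p.1 (false, p.2)]).
have cv_bij : bijective cv.
  exists (fun p : {ffun I * J -> 'I_32} * {ffun I * J -> 'I_32} =>
    [ffun i => [ffun l : L => if l.1 then p.1 (i, l.2) else p.2 (i, l.2)]]).
    by move=> G; apply/ffunP => i; apply/ffunP => -[[] j]; rewrite !ffunE.
  by case=> H1 H2; congr (_, _); apply/ffunP => -[i j]; rewrite !ffunE.
pose S (H : {ffun I * J -> 'I_32}) : R :=
  (solves N (fun i j => lazy (H (i, j))) x (fun=> 0) y (fun=> 0))%:R.
have -> : lazy_kill R N y x ^+ 2 = avg (fun p => S p.1 * S p.2).
  rewrite avg_pair expr2 -avgMr; apply: eq_avg => H1 /=; by rewrite avgMl.
rewrite -(avg_bij _ cv_bij); apply: eq_avg => G /=.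
rewrite /S -!natrM !mulnb /solves; congr (nat_of_bool _)%:R.
apply/idP/idP.
  case/andP => /andP[/forallP a1 /forallP a2] /andP[/forallP a3 /forallP a4].
  apply/andP; split; apply/forallP.
    move=> i; apply/forallP => -[]; [have := a1 i|have := a3 i]; rewrite subr0;
    by congr (_ %| _)%Z; apply: eq_bigr => j _; rewrite ffunE.
  move=> -[[] j]; [have := a2 j|have := a4 j]; rewrite subr0;
  by congr (_ %| _)%Z; apply: eq_bigr => i _; rewrite ffunE.
case/andP => /forallP a1 /forallP a2.
apply/andP; split; apply/andP; split; apply/forallP.
- move=> i; have /forallP/(_ true) := a1 i; rewrite subr0.
  by congr (_ %| _)%Z; apply: eq_bigr => j _; rewrite ffunE.
- move=> j; have := a2 (true, j); rewrite subr0.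
  by congr (_ %| _)%Z; apply: eq_bigr => i _; rewrite ffunE.
- move=> i; have /forallP/(_ false) := a1 i; rewrite subr0.
  by congr (_ %| _)%Z; apply: eq_bigr => j _; rewrite ffunE.
- move=> j; have := a2 (false, j); rewrite subr0.
  by congr (_ %| _)%Z; apply: eq_bigr => i _; rewrite ffunE.
Qed.

(* Since [al ^+ (#|I| - #|L|)] and [tau N^2] are below [1/N], the loss [N ^ (#|L| - #|A|)] from a
   rank deficient [G] is absorbed by the rows outside [A]. *)
Lemma basis_term_le A : 0 <= tau -> tau * N%:R ^+ 3 <= 1 ->
  (#|{: bool * J}| <= #|I|)%N -> al ^+ (#|I| - #|{: bool * J}|) * N%:R <= 1 ->
  (#|A| <= #|{: bool * J}|)%N ->
  (9%:R / N%:R ^+ 2 + tau) ^+ #|A| *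
  (9%:R / N%:R ^+ 2 * al ^+ (#|{: bool * J}| - #|A|) + tau) ^+ #|~: A| * N%:R^-1 ^+ #|A|
  <= (10%:R / N%:R ^+ 2) ^+ #|I| * N%:R^-1 ^+ #|{: bool * J}|.
Proof.
move=> tau0 tauN LI alN AL; set k := (_ - #|A|)%N.
have N1 : 1 <= N%:R :> R by rewrite ler1n.
have iN0 : 0 <= N%:R^-1 :> R by rewrite invr_ge0 ler0n.
have tau_le : tau <= N%:R^-1 ^+ 2 * N%:R^-1.
  by rewrite -exprSr exprVn -[leRHS]mul1r ler_pdivlMr ?exprn_gt0.
have iN1 : N%:R^-1 <= 1 :> R by rewrite invf_le1.
have iN2 : 0 <= N%:R^-1 ^+ 2 :> R by rewrite exprn_ge0.
have al01 : 0 <= al <= 1 by apply/andP; split; lra.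
have [al0 al1] := andP al01.
pose m := Num.max (al ^+ k) N%:R^-1.
have m0 : 0 <= m by rewrite le_max iN0 orbT.
have b0_le : 9%:R / N%:R ^+ 2 + tau <= 10%:R / N%:R ^+ 2 by rewrite -exprVn; nra.
have b1_le : 9%:R / N%:R ^+ 2 * al ^+ k + tau <= 10%:R / N%:R ^+ 2 * m.
  have h1 : al ^+ k <= m by rewrite le_max lexx.
  have h2 : N%:R^-1 <= m by rewrite le_max lexx orbT.
  by rewrite -exprVn; nra.
have mk : m ^+ #|~: A| <= N%:R^-1 ^+ k.
  have cA : (#|I| - #|{: bool * J}| <= #|~: A|)%N by rewrite cardsCs setCK leq_sub2l.
  rewrite /m; case: (leP (al ^+ k) N%:R^-1) => _.
    apply: ler_wiXn2l => //; rewrite cardsCs setCK; apply: leq_sub2r => //.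
  rewrite -exprM mulnC exprM; apply: lerXn2r; rewrite ?nnegrE ?exprn_ge0 //.
  apply: le_trans (_ : al ^+ (#|I| - #|{: bool * J}|) <= _); first exact: ler_wiXn2l.
  by rewrite -[leRHS]mul1r ler_pdivlMr.
have b00 : 0 <= 9%:R / N%:R ^+ 2 + tau by rewrite addr_ge0 // divr_ge0 ?exprn_ge0 ?ler0n.
have b10 : 0 <= 9%:R / N%:R ^+ 2 * al ^+ k + tau.
  by rewrite addr_ge0 // mulr_ge0 ?divr_ge0 ?exprn_ge0 ?ler0n.
apply: le_trans (_ : (10%:R / N%:R ^+ 2) ^+ #|A| * ((10%:R / N%:R ^+ 2) ^+ #|~: A| * N%:R^-1 ^+ k)
    * N%:R^-1 ^+ #|A| <= _).
  apply: ler_wpM2r; first exact: exprn_ge0.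
  apply: ler_pM; rewrite ?exprn_ge0 //.
    by apply: lerXn2r; rewrite ?nnegrE // (le_trans b00).
  apply: le_trans (_ : (10%:R / N%:R ^+ 2 * m) ^+ #|~: A| <= _).
    by apply: lerXn2r; rewrite ?nnegrE // (le_trans b10).
  by rewrite exprMn; apply: ler_wpM2l; rewrite ?exprn_ge0 ?divr_ge0 ?exprn_ge0 ?ler0n.
by rewrite mulrA -exprD cardsC -mulrA -exprD subnK.
Qed.

(** Union bound over the set [A] of basis rows of the doubled block modulo 3: there are at most
    2^#|I| sets, which turns the 10 of [basis_term_le] into 20. *)
Lemma avg_lazy_kill_sqr_le : 0 <= tau -> tau * N%:R ^+ 3 <= 1 ->
  (#|{: bool * J}| <= #|I|)%N -> al ^+ (#|I| - #|{: bool * J}|) * N%:R <= 1 ->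
  avg (fun y : {ffun I -> 'I_N} => lazy_kill R N (fun i => (y i)%:Z) x ^+ 2) <=
  20%:R ^+ #|I| / N%:R ^+ (2 * (#|I| + #|J|)).
Proof.
move=> tau0 tauN LI alN.
rewrite (eq_avg (fun y => lazy_kill_sqrE _)) avg_avgC.
pose ev A G := [forall i, kills (G i) && ((i \in A) || rows_le A G (G i))].
pose P A := (#|A| <= #|{: bool * J}|)%N.
apply: le_trans (_ : avg (fun G => \sum_(A : {set I} | P A) (ev A G)%:R * N%:R^-1 ^+ #|A|) <= _).
  apply: ler_avg => G; rewrite avgMl.
  have [A [Afree Aspan]] := exists_basis_rows (lz G).
  have PA : P A by move: Afree; rewrite /row_free /P => /eqP <-; apply: rank_leq_col.
  rewrite (bigD1 A) //=; apply: ler_wpDr.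
    by apply: sumr_ge0 => A' _; rewrite mulr_ge0 ?exprn_ge0 ?invr_ge0 ?ler0n.
  apply: ler_pM; rewrite ?ler0n //; first by apply: avg_ge0 => y; rewrite ler0n.
    apply: ler_ind => /forallP kG; apply/forallP => i; rewrite kG /=.
    by apply/orP; right; apply: Aspan.
  exact: avg_solutions_le.
rewrite avg_sum; pose b : R := (10%:R / N%:R ^+ 2) ^+ #|I| * N%:R^-1 ^+ #|{: bool * J}|.
have b0 : 0 <= b by rewrite mulr_ge0 ?exprn_ge0 ?divr_ge0 ?exprn_ge0 ?invr_ge0 ?ler0n.
apply: le_trans (_ : \sum_(A : {set I}) b <= _).
  rewrite [leRHS](bigID P) /= -[leLHS]addr0; apply: lerD; last by apply: sumr_ge0.
  apply: ler_sum => A PA; rewrite avgMr.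
  apply: le_trans (basis_term_le tau0 tauN LI alN PA).
  apply: ler_wpM2r; first by rewrite exprn_ge0 ?invr_ge0 ?ler0n.
  exact: avg_kills_span_le.
rewrite sumr_const -[#|_|]cardsT -powersetT card_powerset cardsT -[b *+ _]mulr_natl natrX /b mulrA -exprMn.
rewrite le_eqVlt; apply/orP; left; apply/eqP.
rewrite (_ : 2%:R * (10%:R / N%:R ^+ 2) = 20%:R * N%:R ^- 2); last by ring.
rewrite exprMn -!exprVn -exprM -mulrA -exprD card_prod card_bool.
by rewrite mulnDr.
Qed.

End SecondMoment.

(** * Atypical vectors *)

Section Atypical.
Variables (R : realFieldType) (j0 : nat) (c : int -> R).
Let N := (3 ^ j0)%N.
Hypothesis cP : cosine_like N c.
Variables (m : nat) (eps : R).
Hypothesis m_gt0 : (0 < m)%N.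
Hypothesis epsE : 8%:R * m%:R ^+ 2 * eps = 1.

Let N0 : (0 < N)%N. Proof. by rewrite expn_gt0. Qed.
Let mr0 : 0 < m%:R :> R. Proof. by rewrite ltr0n. Qed.

Lemma near1_multiples z (k : nat) : 1 - c z < eps -> (k < 2 * m)%N ->
  1 / 2%:R <= c (k%:Z * z).
Proof.
move=> zs km; have := cos_mul_le cP k z.
have s0 : 0 <= 1 - c z by rewrite subr_ge0 (cos_le1 cP).
have k2 : k%:R ^+ 2 <= 4%:R * m%:R ^+ 2 :> R.
  rewrite (_ : 4%:R * m%:R ^+ 2 = (2 * m)%N%:R ^+ 2); last by rewrite natrM; ring.
  by apply: lerXn2r; rewrite ?nnegrE ?ler0n ?ler_nat // ltnW.
have : k%:R ^+ 2 * (1 - c z) <= 4%:R * m%:R ^+ 2 * eps.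
  by apply: ler_pM => //; [exact: exprn_ge0|exact: ltW].
by have := epsE; lra.
Qed.

Lemma avg_cos_prod (r s : int) :
  avg (fun x : 'I_N => c (r * x%:Z) * c (s * x%:Z)) =
  ((N %| r + s)%Z%:R + (N %| r - s)%Z%:R) / 2%:R.
Proof.
have e u : (N %| u)%Z%:R = avg (fun x : 'I_N => c (0 + x%:Z * u)) :> R.
  by rewrite (avg_cos_ord cP) ?dvdz_mulr // (cos0 cP) mul1r.
rewrite !e -avgD -avgMr; apply: eq_avg => x.
have := cosD cP (r * x%:Z) (s * x%:Z); rewrite !add0r.
rewrite -mulrDl -mulrBl [x%:Z * (r + s)]mulrC [x%:Z * (r - s)]mulrC => ->.
by field.
Qed.

(** Let t x be close to 0, so that its multiples by k < 2 m have cosine at least 1/2. If such a k >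
    0 kills t modulo [N], these cosines would sum to 0 over a period, which is absurd. Otherwise [F]
    has mean square at most [m] by orthogonality and is at least m/2 on the event, and Chebyshev's
    inequality gives m / (m/2)^2. *)
Lemma avg_near1_le (t : int) : ~~ (N %| t)%Z ->
  avg (fun x : 'I_N => (~~ (3 %| x)%N && (1 - c (t * x%:Z) < eps))%:R) <= 4%:R / m%:R :> R.
Proof.
move=> Nt; have [/existsP[k /andP[k0 Nk]]|] :=
  boolP [exists k : 'I_(2 * m), (0 < k)%N && (N %| k%:Z * t)%Z].
  apply: avg_le_bound => [|x]; first by rewrite divr_ge0 ?ler0n.
  case: andP => [[x3 xs]|_]; last by rewrite divr_ge0 ?ler0n.
  exfalso.
  have Nz : ~~ (N %| t * x%:Z)%Z.
    apply: contra Nt; rewrite mulrC Gauss_dvdzr // coprimezE /= coprimeXl //.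
    by rewrite prime_coprime.
  have := @sum_cos_ord _ _ _ cP k (t * x%:Z) 0; rewrite mulrA dvdz_mulr //.
  have k_lt : (k < 2 * m)%N by [].
  have pos (i : 'I_k) : 1 / 2%:R <= c (0 + i%:Z * (t * x%:Z)).
    by rewrite add0r near1_multiples // (leq_trans (ltn_ord i)) // ltnW.
  have h12 : 0 <= 1 / 2%:R :> R by lra.
  move=> /(_ isT Nz) S0; have := pos (Ordinal k0).
  by rewrite (psumr_eq0P (fun i _ => le_trans h12 (pos i)) S0) //; lra.
rewrite negb_exists => /forallP nk.
have {}nk (k : nat) : (0 < k < 2 * m)%N -> (N %| k%:Z * t)%Z = false.
  by case/andP=> k0 km; have := nk (Ordinal km); rewrite k0 => /negbTE.
pose F (x : 'I_N) := \sum_(k < m) c ((k%:Z * t) * x%:Z).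
have F2 : avg (fun x => F x ^+ 2) <= m%:R.
  rewrite (eq_avg (g := fun x : 'I_N => \sum_(k < m) \sum_(l < m)
      c ((k%:Z * t) * x%:Z) * c ((l%:Z * t) * x%:Z))); last first.
    by move=> x; rewrite expr2 /F mulr_suml; apply: eq_bigr => k _; rewrite mulr_sumr.
  rewrite avg_sum (eq_bigr (fun k : 'I_m => \sum_(l < m)
     ((N %| k%:Z * t + l%:Z * t)%Z%:R + (N %| k%:Z * t - l%:Z * t)%Z%:R) / 2%:R)); last first.
    by move=> k _; rewrite avg_sum; apply: eq_bigr => l _; rewrite avg_cos_prod.
  rewrite -[leRHS](_ : \sum_(k < m) (1 : R) = _); last by rewrite sumr_const card_ord.
  apply: ler_sum => k _; rewrite (bigD1 k) //= big1 ?addr0 => [|l lk].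
    have b1 u : (N %| u)%Z%:R <= 1 :> R by rewrite lern1 leq_b1.
    by have := b1 (k%:Z * t + k%:Z * t); have := b1 (k%:Z * t - k%:Z * t); lra.
  rewrite -mulrDl -mulrBl -PoszD nk /=; last first.
    by have := ltn_ord k; have := ltn_ord l; move: lk; rewrite -val_eqE /=; lia.
  have [kl|kl] := leqP k l.
    rewrite -[k%:Z - _]opprB mulNr rpredN subzn // nk ?addr0 ?mul0r //.
    by have := ltn_ord l; move: lk kl; rewrite -val_eqE /=; lia.
  rewrite subzn ?(ltnW kl) // nk ?addr0 ?mul0r //.
  by have := ltn_ord k; move: kl; lia.
rewrite ler_pdivlMr // -avgMr.
have -> : 4%:R = (4%:R / m%:R) * m%:R :> R by rewrite divfK // gt_eqF.
apply: le_trans (_ : 4%:R / m%:R * avg (fun x => F x ^+ 2) <= _); last first.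
  by apply: ler_wpM2l; rewrite ?divr_ge0 ?ler0n.
rewrite -avgMl; apply: ler_avg => x.
case: andP => [[_ xs]|_]; last by rewrite mul0r mulr_ge0 ?sqr_ge0 ?divr_ge0 ?ler0n.
have Fx : m%:R / 2%:R <= F x.
  have -> : m%:R / 2%:R = \sum_(k < m) (1 / 2%:R) :> R.
    by rewrite sumr_const card_ord -[_ *+ m]mulr_natl; field.
  apply: ler_sum => k _; rewrite -mulrA near1_multiples //.
  by rewrite (leq_trans (ltn_ord k)) // leq_pmull.
rewrite mul1r -[leLHS](_ : 4%:R / m%:R * (m%:R / 2%:R) ^+ 2 = _); last first.
  by field; rewrite gt_eqF.
apply: ler_wpM2l; first by rewrite divr_ge0 ?ler0n.
by apply: lerXn2r; rewrite ?nnegrE // ?(le_trans _ Fx) // divr_ge0 ?ler0n.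
Qed.

Variable J : finType.

Definition decay : R := (1 - eps / 144%:R) ^+ (#|J| ./2).

Definition typicalb (x : J -> int) : bool :=
  [forall t : 'I_N, ~~ (N %| t%:Z)%Z ==> (\prod_j phi c (1 / 144%:R) (t%:Z * x j) <= decay)].

Lemma typicalbP x : typicalb x -> typical N c x decay.
Proof.
move=> /forallP tb t Nt.
have tN0 : (0 <= t %% N)%Z by rewrite modz_ge0 // eqz_nat -lt0n.
have tN : (`|(t %% N)%Z| < N)%N by rewrite -ltz_nat gez0_abs // ltz_pmod.
have tE : t = `|(t %% N)%Z|%N%:Z + (t %/ N)%Z * N%:Z by rewrite gez0_abs // addrC -divz_eq.
have Ns : ~~ (N %| (Ordinal tN)%:Z)%Z.
  by apply: contra Nt => Ns; rewrite tE rpredD // dvdz_mull.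
have := tb (Ordinal tN); rewrite Ns /=; apply: le_trans; apply: ler_prod => j _.
rewrite (phi_ge0 cP) /=; [|lra|lra].
rewrite {1}tE mulrDl (phi_periodic cP) //.
by rewrite mulrAC dvdz_mull.
Qed.

(** If fewer than half of the coordinates have t x_j close to 0, the others already force the
    product below [decay]. So an atypical x comes with a character t and a set [S] of at least half
    the coordinates where t x_j is close to 0, and the union bound runs over both. *)
Lemma avg_atypical_le : (4 <= m)%N ->
  avg (fun x : {ffun J -> 'I_N} =>
    ([forall j, ~~ (3 %| x j)%N] && ~~ typicalb (fun j => (x j)%:Z))%:R) <=
  N%:R * 2%:R ^+ #|J| * (4%:R / m%:R) ^+ (#|J| ./2) :> R.
Proof.
move=> m4; pose low (t : 'I_N) (x : 'I_N) := ~~ (3 %| x)%N && (1 - c (t%:Z * x%:Z) < eps).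
pose q : R := 4%:R / m%:R.
have q0 : 0 <= q by rewrite divr_ge0 ?ler0n.
have q1 : q <= 1 by rewrite ler_pdivrMr // mul1r ler_nat.
have eps0 : 0 < eps.
  have m2 : 0 < 8%:R * m%:R ^+ 2 :> R by rewrite mulr_gt0 // exprn_gt0.
  by rewrite -(pmulr_rgt0 eps m2) epsE.
have eps1 : eps <= 1.
  have m2 : 1 <= m%:R ^+ 2 :> R by rewrite exprn_ege1 // ler1n.
  by rewrite -epsE; nra.
pose P (S : {set J}) := (#|J| ./2 <= #|S|)%N.
apply: le_trans (_ : avg (fun x : {ffun J -> 'I_N} => \sum_(t : 'I_N | ~~ (N %| t%:Z)%Z)
   \sum_(S : {set J} | P S) \prod_j (if j \in S then (low t (x j))%:R else 1 : R)) <= _).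
  apply: ler_avg => x; case: andP => [[/forallP x3]|_]; last first.
    by do 2!(apply: sumr_ge0 => ? _); apply: prodr_ge0 => j _; case: ifP.
  rewrite /typicalb negb_forall => /existsP[t]; rewrite negb_imply => /andP[Nt ht].
  pose S := [set j | low t (x j)].
  have PS : P S.
    apply: contraR ht; rewrite /P -ltnNge => ltS.
    pose om : R := 1 - eps / 144%:R.
    have om01 : 0 <= om <= 1 by apply/andP; split; rewrite /om; lra.
    have [om0 om1] := andP om01.
    apply: le_trans (_ : \prod_j (if j \in S then 1 else om) <= _).
      apply: ler_prod => j _; rewrite (phi_ge0 cP) /=; [|lra|lra].
      rewrite inE /low x3 /=; case: ifP => [_|/negbT]; first by rewrite (phi_le1 cP) //; lra.
      by rewrite -leNgt /phi /om; lra.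
    rewrite (bigID (mem S)) /= big1 ?mul1r => [|j ->] //.
    rewrite (eq_bigr (fun=> om)) => [|j /negbTE ->] //.
    rewrite (eq_bigl (mem (~: S))) => [|j]; last by rewrite !inE.
    rewrite prodr_const; apply: ler_wiXn2l => //.
    have := cardsC S; have := odd_double_half #|J|; move: ltS; rewrite -addnn; lia.
  rewrite (bigD1 t) //= (bigD1 S) //=.
  rewrite big1 => [|j _]; last by case: ifP => //; rewrite inE => ->.
  rewrite -addrA lerDl addr_ge0 // sumr_ge0 // => ? _.
    by apply: prodr_ge0 => j _; case: ifP.
  by apply: sumr_ge0 => ? _; apply: prodr_ge0 => j _; case: ifP.
rewrite avg_sum.
apply: le_trans (_ : \sum_(t : 'I_N | ~~ (N %| t%:Z)%Z) \sum_(S : {set J} | P S) q ^+ (#|J| ./2) <= _).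
  apply: ler_sum => t Nt; rewrite avg_sum; apply: ler_sum => S PS.
  rewrite (avg_prod (fun j (xj : 'I_N) => if j \in S then (low t xj)%:R else 1)).
  apply: le_trans (_ : q ^+ #|S| <= _); last exact: ler_wiXn2l.
  rewrite -prodr_const [leRHS]big_mkcond; apply: ler_prod => j _ /=.
  case: ifP => _; last by rewrite avg_const ?card_ord // lexx ler01.
  by rewrite avg_near1_le // andbT; apply: avg_ge0 => ?; rewrite ler0n.
have qd0 : 0 <= q ^+ (#|J| ./2) by rewrite exprn_ge0.
apply: le_trans (_ : \sum_(t : 'I_N) \sum_(S : {set J}) q ^+ (#|J| ./2) <= _).
  rewrite [leRHS](bigID (fun t : 'I_N => ~~ (N %| t%:Z)%Z)) /= -[leLHS]addr0.
  apply: lerD; last by apply: sumr_ge0 => ? _; apply: sumr_ge0.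
  apply: ler_sum => t _; rewrite [leRHS](bigID P) /= lerDl.
  exact: sumr_ge0.
rewrite !sumr_const -[#|{set J}|]cardsT -powersetT card_powerset cardsT card_ord.
by rewrite -mulrnA -[_ *+ _]mulr_natl natrM natrX [2%:R ^+ _ * _]mulrC.
Qed.

End Atypical.

(** * Averages over symmetric sign matrices *)

Lemma sgnXor a b : sgn (a (+) ~~ b) = sgn b * sgn a.
Proof. by case: a; case: b. Qed.

Lemma signmxE n (B : 'M[bool]_n) i j : signmx B i j = sgn (B i j).
Proof. by rewrite mxE. Qed.

Lemma sgn_unit b : (sgn b == 1) || (sgn b == -1).
Proof. by case: b. Qed.

Lemma symP n (B : 'M[bool]_n) i j : B \in sym_sign n -> B i j = B j i.
Proof. by rewrite inE => /eqP BT; rewrite -{1}BT mxE. Qed.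

Lemma sym_sign_gt0 n : (0 < #|sym_sign n|)%N.
Proof.
by apply/card_gt0P; exists (const_mx true); rewrite inE trmx_const.
Qed.

Section SymAverage.
Variables (R : realFieldType) (n : nat).

Definition sym_avg (f : 'M[bool]_n -> R) : R :=
  #|sym_sign n|%:R^-1 * \sum_(B in sym_sign n) f B.

Lemma ler_sym_avg f g : (forall B, B \in sym_sign n -> f B <= g B) -> sym_avg f <= sym_avg g.
Proof. by move=> fg; rewrite ler_wpM2l ?invr_ge0 ?ler0n //; apply: ler_sum. Qed.

Lemma sym_avg_const a : sym_avg (fun=> a) = a.
Proof.
rewrite /sym_avg sumr_const -[a *+ _]mulr_natl mulKf //.
by rewrite pnatr_eq0 -lt0n sym_sign_gt0.
Qed.

Lemma sym_avg_le f a : (forall B, B \in sym_sign n -> f B <= a) -> sym_avg f <= a.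
Proof. by move=> fa; rewrite -[leRHS]sym_avg_const; apply: ler_sym_avg. Qed.

Lemma sym_avg_ge0 f : (forall B, 0 <= f B) -> 0 <= sym_avg f.
Proof. by move=> f0; rewrite -[leLHS]sym_avg_const; apply: ler_sym_avg. Qed.

Lemma sym_avg_sum (I : finType) (P : pred I) (f : I -> 'M[bool]_n -> R) :
  sym_avg (fun B => \sum_(i | P i) f i B) = \sum_(i | P i) sym_avg (f i).
Proof. by rewrite /sym_avg exchange_big mulr_sumr. Qed.

Lemma sym_avgMl a f : sym_avg (fun B => a * f B) = a * sym_avg f.
Proof. by rewrite /sym_avg -mulr_sumr mulrCA. Qed.

Lemma sym_avgD f g : sym_avg (fun B => f B + g B) = sym_avg f + sym_avg g.
Proof. by rewrite /sym_avg big_split mulrDr. Qed.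

Lemma sym_avg_avg (T : finType) (f : T -> 'M[bool]_n -> R) :
  sym_avg (fun B => avg (f^~ B)) = avg (fun x => sym_avg (f x)).
Proof.
rewrite /sym_avg /avg -!mulr_sumr exchange_big /=.
by rewrite !mulrA [_ * _^-1]mulrC.
Qed.

(** Each involution preserves the uniform law, so a random one may be applied first; it then
    suffices to average over it with the matrix held fixed. *)
Lemma sym_avg_resample (T : finType) (fl : T -> 'M[bool]_n -> 'M[bool]_n) f a :
  (0 < #|T|)%N -> (forall g, involutive (fl g)) ->
  (forall g B, B \in sym_sign n -> fl g B \in sym_sign n) ->
  (forall B, B \in sym_sign n -> avg (fun g => f (fl g B)) <= a) -> sym_avg f <= a.
Proof.
move=> T0 flK fl_sym fa.
have inv g : sym_avg f = sym_avg (f \o fl g).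
  rewrite /sym_avg (reindex_inj (inv_inj (flK g))); congr (_ * _).
  apply: eq_bigl => B; apply/idP/idP; last exact: fl_sym.
  by move/(fl_sym g); rewrite flK.
rewrite -(@avg_const _ T (sym_avg f)) // (eq_avg inv) -sym_avg_avg.
exact: sym_avg_le.
Qed.

Section Flip.
Variable D : {set 'I_n}.
Local Notation I := {i : 'I_n | i \notin D}.
Local Notation J := {i : 'I_n | i \in D}.

Lemma sum_split (V : nmodType) (F : 'I_n -> V) :
  \sum_a F a = \sum_(j : J) F (val j) + \sum_(i : I) F (val i).
Proof.
rewrite (bigID (mem D)) /=; congr (_ + _); first exact: big_sub.
exact: (big_sub [pred i | i \notin D] F).
Qed.

(** The negation makes the flipped entry equal to [sgn (G (i, j))] times the old one, by [sgnXor].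
    The two nontrivial cases are the two transposed off-diagonal blocks. *)
Definition flip_mask (G : {ffun I * J -> bool}) (a b : 'I_n) : bool :=
  match (insub a : option I), (insub b : option J), (insub b : option I), (insub a : option J) with
  | Some i, Some j, _, _ => ~~ G (i, j)
  | _, _, Some i, Some j => ~~ G (i, j)
  | _, _, _, _ => false
  end.

Let inI (i : I) : (insub (val i) : option J) = None.
Proof. by rewrite insubF //; apply/negbTE/(valP i). Qed.

Let inJ (j : J) : (insub (val j) : option I) = None.
Proof. by rewrite insubF //; rewrite (valP j). Qed.

Lemma flip_maskIJ G i j : flip_mask G (val i) (val j) = ~~ G (i, j).
Proof. by rewrite /flip_mask !valK. Qed.

Lemma flip_maskJI G i j : flip_mask G (val j) (val i) = ~~ G (i, j).
Proof. by rewrite /flip_mask inJ !valK. Qed.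

Lemma flip_maskII G (i i' : I) : flip_mask G (val i) (val i') = false.
Proof. by rewrite /flip_mask !inI !valK. Qed.

Lemma flip_maskJJ G (j j' : J) : flip_mask G (val j) (val j') = false.
Proof. by rewrite /flip_mask !inJ. Qed.

Lemma flip_maskC G a b : flip_mask G a b = flip_mask G b a.
Proof.
have [aD|aD] := boolP (a \in D); have [bD|bD] := boolP (b \in D).
- by rewrite -[a]/(val (Sub a aD : J)) -[b]/(val (Sub b bD : J)) !flip_maskJJ.
- by rewrite -[a]/(val (Sub a aD : J)) -[b]/(val (Sub b bD : I)) flip_maskJI flip_maskIJ.
- by rewrite -[a]/(val (Sub a aD : I)) -[b]/(val (Sub b bD : J)) flip_maskJI flip_maskIJ.
- by rewrite -[a]/(val (Sub a aD : I)) -[b]/(val (Sub b bD : I)) !flip_maskII.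
Qed.

Definition flip G (B : 'M[bool]_n) : 'M[bool]_n := \matrix_(a, b) (B a b (+) flip_mask G a b).

Lemma flipK G : involutive (flip G).
Proof. by move=> B; apply/matrixP => a b; rewrite !mxE addbK. Qed.

Lemma flip_sym G B : B \in sym_sign n -> flip G B \in sym_sign n.
Proof.
move=> Bs; rewrite inE; apply/eqP/matrixP => a b.
by rewrite !mxE (symP _ _ Bs) flip_maskC.
Qed.

(** Only the off-diagonal blocks are randomised again. The fixed diagonal blocks move into the
    right-hand sides [u] and [w'], in which [sign_block_le] is uniform. *)
Lemma sym_kill_le (N : nat) (c : int -> R) (v w : 'I_n -> int) :
  cosine_like N c -> odd N ->
  sym_avg (fun B => [forall a, (N %| (\sum_b signmx B a b * v b) - w a)%Z]%:R) <=
  lazy_kill R N (fun i : I => v (val i)) (fun j : J => v (val j)).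
Proof.
move=> cP Nodd; apply: (@sym_avg_resample _ flip _ _ _ flipK flip_sym).
  by rewrite card_ffun card_bool expn_gt0.
move=> B Bs; pose e (p : I * J) := signmx B (val p.1) (val p.2).
have e1 p : (e p == 1) || (e p == -1) by rewrite /e signmxE sgn_unit.
pose u (i : I) := w (val i) - \sum_(i' : I) signmx B (val i) (val i') * v (val i').
pose w' (j : J) := w (val j) - \sum_(j' : J) signmx B (val j) (val j') * v (val j').
apply: le_trans (sign_block_le cP Nodd _ u _ w' e1); apply: ler_avg => G; apply: ler_ind => /forallP H.
have eqB (x y z : int) : x + y - z = x - (z - y) by ring.
apply/andP; split; apply/forallP.
  move=> i; have := H (val i); rewrite sum_split.
  rewrite (eq_bigr (fun j => sgn (G (i, j)) * e (i, j) * v (val j))); last first.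
    by move=> j _; rewrite !signmxE mxE flip_maskIJ sgnXor /e signmxE.
  rewrite [X in _ + X - _](eq_bigr (fun i' => signmx B (val i) (val i') * v (val i'))) ?eqB //.
  by move=> i' _; rewrite !signmxE mxE flip_maskII addbF.
move=> j; have := H (val j); rewrite sum_split [X in X - _]addrC.
rewrite [X in X + _ - _](eq_bigr (fun i => sgn (G (i, j)) * e (i, j) * v (val i))); last first.
  by move=> i _; rewrite !signmxE mxE flip_maskJI sgnXor /e signmxE (symP _ _ Bs).
rewrite [X in _ + X - _](eq_bigr (fun j' => signmx B (val j) (val j') * v (val j'))).
  by rewrite eqB.
by move=> j' _; rewrite !signmxE mxE flip_maskJJ addbF.
Qed.

End Flip.

(** Resample the row and column at [j0]. Row a other than [j0] contains a single new sign, with unit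
    coefficient modulo 3, so it determines that sign; row [j0] then determines the diagonal one. At
    most one of the 2^n choices remains. *)
Lemma sym_column_le (w u : 'I_n -> int) (j0 : 'I_n) : ~~ (3 %| u j0)%Z ->
  sym_avg (fun B => [forall a, (3 %| (\sum_b signmx B a b * u b) - w a)%Z]%:R) <= 2%:R^-1 ^+ n.
Proof.
move=> uj0.
pose mask (g : {ffun 'I_n -> bool}) a b := if b == j0 then ~~ g a else if a == j0 then ~~ g b else false.
pose fl g (B : 'M[bool]_n) : 'M[bool]_n := \matrix_(a, b) (B a b (+) mask g a b).
have maskC g a b : mask g a b = mask g b a.
  by rewrite /mask; have [ea|] := eqVneq a j0; have [eb|] := eqVneq b j0; rewrite ?ea ?eb.
apply: (@sym_avg_resample _ fl).
- by rewrite card_ffun card_bool expn_gt0.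
- by move=> g B; apply/matrixP => a b; rewrite !mxE addbK.
- move=> g B Bs; rewrite inE; apply/eqP/matrixP => a b.
  by rewrite !mxE (symP _ _ Bs) maskC.
move=> B Bs; have u0 : 0 <= 2%:R^-1 ^+ n :> R by rewrite exprn_ge0 ?invr_ge0 ?ler0n.
pose sol g := [forall a, (3 %| (\sum_b signmx (fl g B) a b * u b) - w a)%Z].
have [/existsP[g1 s1]|] := boolP [exists g, sol g]; last first.
  rewrite negb_exists => /forallP ns; apply: avg_le_bound => // g.
  by rewrite [X in (nat_of_bool X)%:R](negbTE (ns g)).
have := avg_ind_eq R (T := bool) predT g1; rewrite card_bool [#|_|]card_ord => <-.
apply: ler_avg => g; apply: ler_ind => s.
have dif a b : signmx (fl g B) a b - signmx (fl g1 B) a b =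
    (if b == j0 then sgn (g a) - sgn (g1 a) else if a == j0 then sgn (g b) - sgn (g1 b) else 0) * sgn (B a b).
  rewrite !signmxE !mxE /mask; case: eqP => _; first by rewrite !sgnXor mulrBl.
  by case: eqP => _; rewrite ?sgnXor ?mulrBl // addbF subrr mul0r.
have row a : (3 %| \sum_b (signmx (fl g B) a b - signmx (fl g1 B) a b) * u b)%Z.
  have := rpredB (forallP s a) (forallP s1 a).
  rewrite opprB addrA subrK -sumrB.
  by rewrite (eq_bigr (fun b => (signmx (fl g B) a b - signmx (fl g1 B) a b) * u b)) // => b _; rewrite mulrBl.
have sgn_inj b b' r : (3 %| (sgn b - sgn b') * sgn r * u j0)%Z -> b = b'.
  have u3 : coprimez 3 (u j0) by rewrite coprimezE prime_coprime //.
  by rewrite mulrC Gauss_dvdzr //; case: b; case: b'; case: r.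
have off a : a != j0 -> g a = g1 a.
  move=> aj; have := row a; rewrite (bigD1 j0) //= dif eqxx big1 ?addr0; first exact: sgn_inj.
  by move=> b /negbTE bj; rewrite dif bj (negbTE aj) !mul0r.
apply/forallP => a; apply/implyP => _; apply/eqP.
have [->|/off //] := eqVneq a j0.
have := row j0; rewrite (bigD1 j0) //= dif eqxx big1 ?addr0; first exact: sgn_inj.
by move=> b bj; rewrite dif (negbTE bj) eqxx off // subrr !mul0r.
Qed.

End SymAverage.

(** * Invariance of [lazy_kill] and frequency of rich vectors *)

Section LazyKill.
Variables (R : realFieldType) (I J : finType).
Implicit Types (y : I -> int) (x : J -> int).

Lemma lazy_kill_le1 N y x : lazy_kill R N y x <= 1.
Proof. by apply: avg_le_bound => // H; rewrite lern1 leq_b1. Qed.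

Lemma lazy_kill_dvd N N' y x : (N' %| N)%N -> lazy_kill R N y x <= lazy_kill R N' y x.
Proof.
move=> NN'; apply: ler_avg => H; apply: ler_ind => /andP[/forallP a1 /forallP a2].
by apply/andP; split; apply/forallP => i; [apply: dvdz_trans (a1 i)|apply: dvdz_trans (a2 i)].
Qed.

Lemma lazy_kill_eqmod (N : nat) y y' x x' :
  (forall i, (N %| y i - y' i)%Z) -> (forall j, (N %| x j - x' j)%Z) ->
  lazy_kill R N y x = lazy_kill R N y' x'.
Proof.
have dvd_eqmod (T : finType) (h v v' : T -> int) : (forall i, (N %| v i - v' i)%Z) ->
    (N %| (\sum_i h i * v i) - 0)%Z = (N %| (\sum_i h i * v' i) - 0)%Z.
  move=> vv'; rewrite !subr0 -[\sum_i h i * v i](subrK (\sum_i h i * v' i)).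
  rewrite rpredDl // -sumrB; apply: rpred_sum => i _.
  by rewrite -mulrBr dvdz_mull.
move=> yy' xx'; apply: eq_avg => H; congr (nat_of_bool _)%:R; congr andb;
  by apply: eq_forallb => i; apply: dvd_eqmod.
Qed.

End LazyKill.

(** The first term counts the atypical [x]. For a typical [x], Markov's inequality applied to the
    square of [lazy_kill] gives the second. *)
Lemma avg_rich_le (R : realFieldType) (j0 : nat) (c : int -> R) (m : nat) (eps : R)
    (I J : finType) (th : R) (N := (3 ^ j0.+1)%N) :
  cosine_like N c -> 8%:R * m%:R ^+ 2 * eps = 1 -> (4 <= m)%N -> 0 < th ->
  decay eps J * N%:R ^+ 3 <= 1 -> (#|{: bool * J}| <= #|I|)%N ->
  (15%:R / 16%:R) ^+ (#|I| - #|{: bool * J}|) * N%:R <= 1 :> R ->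
  avg (fun x : {ffun J -> 'I_N} => avg (fun y : {ffun I -> 'I_N} =>
    ([forall j, ~~ (3 %| x j)%N] &&
     (th <= lazy_kill R N (fun i => (y i)%:Z) (fun j => (x j)%:Z)))%:R)) <=
  N%:R * 2%:R ^+ #|J| * (4%:R / m%:R) ^+ (#|J| ./2) +
  20%:R ^+ #|I| / (N%:R ^+ (#|I| + #|J|) * th) ^+ 2.
Proof.
move=> cP epsE m4 th0 decN JI alN.
have m0 : (0 < m)%N by apply: leq_trans m4.
have N0 : (0 < N)%N by rewrite expn_gt0.
have Nr0 : 0 < N%:R :> R by rewrite ltr0n.
have eps0 : 0 < eps.
  have m2 : 0 < 8%:R * m%:R ^+ 2 :> R by rewrite mulr_gt0 // exprn_gt0 // ltr0n.
  by rewrite -(pmulr_rgt0 eps m2) epsE.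
have dec0 : 0 <= decay eps J.
  have m2 : 1 <= m%:R ^+ 2 :> R by rewrite exprn_ege1 // ler1n.
  by rewrite exprn_ge0 //; nra.
apply: le_trans (lerD (avg_atypical_le cP m0 epsE J m4) (lexx _)).
set b := _ / _ ^+ 2.
have b0 : 0 <= b by rewrite divr_ge0 ?exprn_ge0 ?mulr_ge0 ?exprn_ge0 ?ler0n // ltW.
have nJ : (0 < #|{ffun J -> 'I_N}|)%N by rewrite card_ffun card_ord expn_gt0 N0.
rewrite -[X in _ + X](avg_const b nJ) -avgD; apply: ler_avg => x.
set X3 := [forall j, _]; set T := typicalb _ _ _ _.
have [hT|_] := boolP T; last first.
  rewrite andbT; apply: le_trans (_ : X3%:R <= _); last by rewrite lerDl.
  by apply: avg_le_bound => // y; apply: ler_ind => /andP[].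
rewrite andbF add0r.
have typ : typical N c (fun j => (x j)%:Z) (decay eps J).
  exact: (typicalbP cP).
have := avg_lazy_kill_sqr_le cP typ dec0 decN JI alN.
rewrite -(ler_pM2r (x := (th ^+ 2)^-1)) ?invr_gt0 ?exprn_gt0 // -avgMr.
set a := _ / _ / _ => h; have ab : a = b.
  by rewrite /a /b exprMn -exprM [(2 * _)%N]mulnC [(_ * th ^+ 2)^-1]invfM mulrA.
rewrite -ab; apply: le_trans h; apply: ler_avg => y.
case: andP => [[_ ky]|_]; last by rewrite mulr_ge0 ?sqr_ge0 // invr_ge0 sqr_ge0.
rewrite -expr_div_n exprn_ege1 // ler_pdivlMr // mul1r //.
Qed.

Lemma avg_ffun_split (R : realFieldType) (n : nat) (D : {set 'I_n}) (K : finType)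
    (F : {ffun {i | i \in D} -> K} -> {ffun {i | i \notin D} -> K} -> R) :
  avg (fun v : {ffun 'I_n -> K} => F [ffun j => v (val j)] [ffun i => v (val i)]) =
  avg (fun x => avg (F x)).
Proof.
pose h (v : {ffun 'I_n -> K}) : {ffun {i | i \in D} -> K} * {ffun {i | i \notin D} -> K} :=
  ([ffun j => v (val j)], [ffun i => v (val i)]).
rewrite -(avg_pair (fun p => F p.1 p.2)) -[RHS](avg_bij _ (h := h)) //.
apply: inj_card_bij.
  move=> v v' [/ffunP e1 /ffunP e2]; apply/ffunP => a.
  have [aD|aD] := boolP (a \in D).
    by have := e1 (Sub a aD); rewrite !ffunE.
  by have := e2 (Sub a aD); rewrite !ffunE.
rewrite card_prod !card_ffun -expnD !card_sig -[in leqRHS](cardC (mem D)) leq_eqVlt.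
by apply/orP; left.
Qed.

(** * Structured solutions *)

Lemma ind_exists_le (R : numDomainType) (T : finType) (P : pred T) :
  [exists x, P x]%:R <= \sum_x (P x)%:R :> R.
Proof.
case: existsP => [[x Px]|_]; last by apply: sumr_ge0 => x _; rewrite ler0n.
by rewrite (bigD1 x) //= Px lerDl sumr_ge0 // => y _; rewrite ler0n.
Qed.

Lemma ind_and (R : pzSemiRingType) (a b : bool) : (a && b)%:R = a%:R * b%:R :> R.
Proof. by rewrite -natrM mulnb. Qed.

Definition kernel_eq n (N : nat) (w v : 'I_n -> int) (t : int) (B : 'M[bool]_n) : bool :=
  [forall a, (N %| (\sum_b signmx B a b * v b) - t * w a)%Z].

Section Structure.
Variables (R : realFieldType) (n d J L : nat).
Variable w : 'I_n -> int.
Implicit Types (D : {set 'I_n}) (B : 'M[bool]_n) (v : 'I_n -> int).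

Definition kill_prob D (N : nat) v : R :=
  lazy_kill R N (fun i : {i | i \notin D} => v (val i)) (fun j : {i | i \in D} => v (val j)).

Definition supp3 (u : {ffun 'I_n -> 'I_3}) := #|[set i | u i != 0 :> nat]|.

Definition bad_sparse B : bool :=
  [exists u : {ffun 'I_n -> 'I_3}, [exists t : 'I_3,
    (0 < supp3 u < d)%N && kernel_eq 3 w (fun i => (u i)%:Z) t%:Z B]].

Lemma card_notin_in D : (#|{: {i : 'I_n | i \notin D}}| + #|{: {i : 'I_n | i \in D}}|)%N = n.
Proof. by rewrite !card_sig addnC -[RHS]card_ord -(cardC (mem D)). Qed.

Definition rich D (N : nat) v : bool :=
  [forall a, (a \in D) ==> ~~ (3 %| v a)%Z] && ((L%:R / N%:R) ^+ n <= kill_prob D N v).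

(** The upper bound on [kill_prob] belongs to the event: every v counted here then costs at most (3
    L / N)^n in the union bound, only 3^n times the threshold in [rich]. *)
Definition bad_rich B : bool :=
  [exists D : {set 'I_n}, (#|D| == d) && [exists j : 'I_J,
    [exists v : {ffun 'I_n -> 'I_(3 ^ j.+1)}, [exists t : 'I_(3 ^ j.+1),
      (rich D (3 ^ j.+1) (fun i => (v i)%:Z) &&
        (kill_prob D (3 ^ j.+1) (fun i => (v i)%:Z) < (3%:R * L%:R / (3 ^ j.+1)%:R) ^+ n)) &&
      kernel_eq (3 ^ j.+1) w (fun i => (v i)%:Z) t%:Z B]]]].

Definition residue (N : nat) (N0 : (0 < N)%N) (z : int) : 'I_N :=
  Ordinal (ltn_pmod `|(z %% N)%Z| N0).

Lemma residueP N (N0 : (0 < N)%N) z : (N %| z - (residue N0 z)%:Z)%Z.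
Proof.
have z0 : (0 <= z %% N)%Z by rewrite modz_ge0 // eqz_nat -lt0n.
rewrite /= modn_small; last by rewrite -ltz_nat gez0_abs // ltz_pmod.
by rewrite gez0_abs // {1}(divz_eq z N) addrK dvdz_mull.
Qed.

Lemma kernel_eq_residue (N : nat) (N0 : (0 < N)%N) v t B :
  (forall a, \sum_b signmx B a b * v b = t * w a) ->
  kernel_eq N w (fun i => (residue N0 (v i))%:Z) (residue N0 t)%:Z B.
Proof.
move=> Bv; apply/forallP => a.
have -> : \sum_b signmx B a b * (residue N0 (v b))%:Z =
   t * w a - \sum_b signmx B a b * (v b - (residue N0 (v b))%:Z).
  by rewrite -Bv -sumrB; apply: eq_bigr => b _; ring.
rewrite addrAC -mulrBl rpredB ?dvdz_mulr ?residueP //.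
by apply: rpred_sum => b _; rewrite dvdz_mull // residueP.
Qed.

Lemma dvd3_residue N (N0 : (0 < N)%N) z : (3 %| N)%N ->
  (3 %| (residue N0 z)%:Z)%Z = (3 %| z)%Z.
Proof.
move=> N3; have h : (3 %| z - (residue N0 z)%:Z)%Z by apply: dvdz_trans (residueP N0 z).
by rewrite -[z in RHS](subrK (residue N0 z)%:Z) rpredDl.
Qed.

(* [j] below is the least exponent for which [v] is rich modulo [3 ^ j]; minimality bounds
   [kill_prob] modulo [3 ^ (j - 1)], hence modulo [3 ^ j], from above. *)
Lemma not_bad_small_ball (c : nat -> int -> R) B v t :
  (forall j, cosine_like (3 ^ j) (c j)) -> (0 < n)%N -> (1 < L)%N ->
  ~~ bad_sparse B -> ~~ bad_rich B ->
  (exists i, ~~ (3 %| v i)%Z) -> (forall a, \sum_b signmx B a b * v b = t * w a) ->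
  forall s, avg (fun e : {ffun 'I_n -> bool} =>
    ((3 ^ J)%N %| (\sum_i sgn (e i) * v i) - s)%Z%:R) < L%:R / (3 ^ J)%:R :> R.
Proof.
move=> cP n0 L1 nsparse nrich [i0 vi0] Bv s; rewrite ltNge; apply/negP => big.
pose S := [set i | ~~ (3 %| v i)%Z].
have [Sd|dS] := ltnP #|S| d.
  case/negP: nsparse; apply/existsP; exists [ffun i => residue (isT : (0 < 3)%N) (v i)].
  apply/existsP; exists (residue (isT : (0 < 3)%N) t).
  have S3 : supp3 [ffun i => residue (isT : (0 < 3)%N) (v i)] = #|S|.
    apply: eq_card => i; rewrite !inE ffunE; congr (~~ _).
    rewrite -(dvd3_residue (isT : (0 < 3)%N) (v i)) //.
    by case: (residue _ (v i)) => -[|[|[]]].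
  rewrite S3 Sd andbT; apply/andP; split.
    by apply/card_gt0P; exists i0; rewrite inE.
  have := kernel_eq_residue (isT : (0 < 3)%N) Bv; congr is_true.
  by apply: eq_forallb => a; rewrite (eq_bigr _ (fun b _ => congr1 (fun z : 'I_3 => _ * z%:Z) (ffunE _ b))).
have [l [l_uniq l_size lS]] := card_geqP dS.
pose D := [set x in l].
have Dd : #|D| = d by rewrite cardsE; move/card_uniqP: l_uniq => ->.
have Dv a : a \in D -> ~~ (3 %| v a)%Z by rewrite inE => /lS; rewrite inE.
pose th j : R := (L%:R / (3 ^ j)%:R) ^+ n.
have jJ : th J <= kill_prob D (3 ^ J) v.
  have odd3 : odd (3 ^ J) by rewrite oddX orbT.
  apply: le_trans (_ : (avg (fun e : {ffun 'I_n -> bool} =>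
    ((3 ^ J)%N %| (\sum_i sgn (e i) * v i) - s)%Z%:R)) ^+ n <= _).
    have q0 : 0 <= L%:R / (3 ^ J)%:R :> R by rewrite divr_ge0 ?ler0n.
    exact: lerXn2r q0 (le_trans q0 big) big.
  have := sign_sum_pow_le (cP J) odd3 v s (@val_inj _ _ {i | i \notin D}) (@val_inj _ _ {i | i \in D}).
  by rewrite card_notin_in; apply.
have [[|j] thj minj] := ex_minnP (ex_intro (fun j => th j <= kill_prob D (3 ^ j) v) J jJ).
  (* The exponent 0 cannot be minimal: modulo 1 the threshold is L^n > 1. *)
  have := le_trans thj (lazy_kill_le1 _ _ _ _); rewrite /th expn0 divr1 leNgt.
  by rewrite exprn_egt1 ?ltr1n // -lt0n n0.
have j_lt : (j < J)%N by apply: minj.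
have thj' : kill_prob D (3 ^ j) v < th j.
  by rewrite ltNge; apply/negP => /minj; rewrite ltnn.
have N0 : (0 < 3 ^ j.+1)%N by rewrite expn_gt0.
pose v' : {ffun 'I_n -> 'I_(3 ^ j.+1)} := [ffun i => residue N0 (v i)].
have v'E i : (v' i)%:Z = (residue N0 (v i))%:Z by rewrite ffunE.
have kE : kill_prob D (3 ^ j.+1) (fun i => (v' i)%:Z) = kill_prob D (3 ^ j.+1) v.
  by apply: lazy_kill_eqmod => i; rewrite v'E -opprB rpredN residueP.
case/negP: nrich; apply/existsP; exists D; rewrite Dd eqxx /=.
apply/existsP; exists (Ordinal j_lt); apply/existsP; exists v'.
apply/existsP; exists (residue N0 t); rewrite kE; apply/andP; split; last first.
  have := kernel_eq_residue N0 Bv; congr is_true.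
  by apply: eq_forallb => a; rewrite (eq_bigr _ (fun b _ => congr1 (fun z : int => _ * z) (v'E b))).
apply/andP; split; last first.
  apply: le_lt_trans (_ : kill_prob D (3 ^ j) v < _).
    by apply: lazy_kill_dvd; rewrite expnS dvdn_mull.
  move: thj'; rewrite /th /= expnS natrM invfM mulrACA divff ?mul1r //.
  by rewrite pnatr_eq0.
rewrite /rich kE thj andbT; apply/forallP => a; apply/implyP => aD.
by rewrite v'E dvd3_residue ?Dv // expnS dvdn_mulr.
Qed.

Lemma sym_kernel_eq_le (c : int -> R) D (N : nat) v t :
  cosine_like N c -> odd N ->
  sym_avg (fun B => (kernel_eq N w v t B)%:R) <= kill_prob D N v.
Proof. by move=> cP Nodd; apply: (sym_kill_le D v (fun a => t * w a) cP Nodd). Qed.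

(** Exponential weights: each nonzero residue weighs 1/8, so a coordinate contributes 1 + 2/8 = 5/4
    in total, and 8^d compensates the weight of fewer than [d] nonzero entries. *)
Lemma count_sparse_le :
  \sum_(u : {ffun 'I_n -> 'I_3}) (supp3 u < d)%N%:R <= 8%:R ^+ d * (5%:R / 4%:R) ^+ n :> R.
Proof.
pose f (x : 'I_3) : R := if x == 0 :> nat then 1 else 8%:R^-1.
apply: le_trans (_ : \sum_(u : {ffun 'I_n -> 'I_3}) 8%:R ^+ d * \prod_i f (u i) <= _).
  apply: ler_sum => u _.
  have f0 : 0 <= \prod_i f (u i) by apply: prodr_ge0 => i _; rewrite /f; case: ifP => _; rewrite ?invr_ge0.
  case: ltnP => ud; last by rewrite mulr_ge0 ?exprn_ge0.
  rewrite (bigID (fun i => u i == 0 :> nat)) /= big1 ?mul1r; last by move=> i ui; rewrite /f ui.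
  rewrite (eq_bigr (fun=> 8%:R^-1)); last by move=> i /negbTE ui; rewrite /f ui.
  rewrite (eq_bigl (mem [set i | u i != 0 :> nat])); last by move=> i; rewrite !inE.
  rewrite prodr_const -/(supp3 u) exprVn ler_pdivlMr ?exprn_gt0 // mul1r.
  by apply: ler_weXn2l; [rewrite ler1n | exact: ltnW].
rewrite -mulr_sumr -(bigA_distr_bigA (fun _ => f)) /=; apply: ler_wpM2l; first by rewrite exprn_ge0.
rewrite prodr_const card_ord !big_ord_recl big_ord0 /f /=.
by apply: lerXn2r; rewrite ?nnegrE; lra.
Qed.

Lemma sym_bad_sparse_le :
  sym_avg (fun B => (bad_sparse B)%:R) <= 3%:R * 8%:R ^+ d * (5%:R / 8%:R) ^+ n :> R.
Proof.
apply: le_trans (_ : sym_avg (fun B => \sum_(u : {ffun 'I_n -> 'I_3}) \sum_(t : 'I_3)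
   (0 < supp3 u < d)%N%:R * (kernel_eq 3 w (fun i => (u i)%:Z) t%:Z B)%:R) <= _).
  apply: ler_sym_avg => B _; apply: le_trans (ind_exists_le _ _) _; apply: ler_sum => u _.
  by apply: le_trans (ind_exists_le _ _) _; apply: ler_sum => t _; rewrite ind_and.
rewrite sym_avg_sum; apply: le_trans (_ : \sum_(u : {ffun 'I_n -> 'I_3}) \sum_(t : 'I_3)
   (supp3 u < d)%N%:R * 2%:R^-1 ^+ n <= _).
  apply: ler_sum => u _; rewrite sym_avg_sum; apply: ler_sum => t _; rewrite sym_avgMl.
  case: andP => [[u0 ->]|_]; last by rewrite mul0r mulr_ge0 ?ler0n ?exprn_ge0 ?invr_ge0 ?ler0n.
  rewrite !mul1r; have /card_gt0P[i] := u0; rewrite inE => ui.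
  apply: (sym_column_le R (fun a => t%:Z * w a) (j0 := i)).
  by case: (u i) ui => -[|[|[]]].
rewrite (eq_bigr (fun u => 3%:R * 2%:R^-1 ^+ n * (supp3 u < d)%N%:R)); last first.
  by move=> u _; rewrite sumr_const card_ord -[_ *+ 3]mulr_natl; ring.
rewrite -mulr_sumr; apply: le_trans (ler_wpM2l _ count_sparse_le) _.
  by rewrite mulr_ge0 ?exprn_ge0 ?invr_ge0 ?ler0n.
rewrite (_ : 5%:R / 8%:R = 2%:R^-1 * (5%:R / 4%:R)); last by field.
by rewrite [X in _ <= _ * X]exprMn le_eqVlt; apply/orP; left; apply/eqP; ring.
Qed.

End Structure.

(** * Union bound over rich vectors *)

Section RichCount.
Variables (R : realFieldType) (n d J L m : nat) (c : nat -> int -> R) (eps : R).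
Variable w : 'I_n -> int.
Hypothesis cP : forall j, cosine_like (3 ^ j) (c j).
Hypothesis epsE : 8%:R * m%:R ^+ 2 * eps = 1.
Hypothesis m4 : (4 <= m)%N.
Hypothesis L_gt0 : (0 < L)%N.
Hypothesis d3n : (3 * d <= n)%N.
Local Notation Q := (3 ^ J)%N.
Hypothesis decayQ : (1 - eps / 144%:R) ^+ (d ./2) * Q%:R ^+ 3 <= 1.
Hypothesis lazyQ : (15%:R / 16%:R) ^+ (n - 3 * d) * Q%:R <= 1 :> R.
Implicit Types (D : {set 'I_n}) (B : 'M[bool]_n).

Definition rich_bound : R :=
  Q%:R * 2%:R ^+ d * (4%:R / m%:R) ^+ (d ./2) + 20%:R ^+ n / L%:R ^+ n ^+ 2.

Lemma avg_rich_set_le D (j : nat) : #|D| = d -> (j < J)%N ->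
  avg (fun v : {ffun 'I_n -> 'I_(3 ^ j.+1)} =>
    (rich R L D (3 ^ j.+1) (fun i => (v i)%:Z))%:R) <= rich_bound.
Proof.
move=> Dd jJ; set N := (3 ^ j.+1)%N.
have N0 : (0 < N)%N by rewrite expn_gt0.
have Nr0 : 0 < N%:R :> R by rewrite ltr0n.
have NQ : N%:R <= Q%:R :> R by rewrite ler_nat leq_exp2l.
have Lr0 : 0 < L%:R :> R by rewrite ltr0n.
have cJ : #|{: {i : 'I_n | i \in D}}| = d by rewrite card_sig -Dd; apply: eq_card.
have cI : #|{: {i : 'I_n | i \notin D}}| = (n - d)%N.
  by have := card_notin_in D; rewrite cJ => /(canRL (addnK d)).
have c2 : #|{: bool * {i : 'I_n | i \in D}}| = (2 * d)%N by rewrite card_prod card_bool cJ.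
have eps1 : eps <= 1.
  have m2 : 1 <= m%:R ^+ 2 :> R by rewrite exprn_ege1 // ler1n (leq_trans _ m4).
  by have := epsE; nra.
have th0 : 0 < (L%:R / N%:R) ^+ n :> R by rewrite exprn_gt0 // divr_gt0.
have decN : decay eps {i : 'I_n | i \in D} * N%:R ^+ 3 <= 1.
  rewrite /decay cJ; apply: le_trans decayQ; apply: ler_wpM2l.
    by rewrite exprn_ge0 //; lra.
  by apply: lerXn2r; rewrite ?nnegrE ?ler0n.
have JI : (#|{: bool * {i : 'I_n | i \in D}}| <= #|{: {i : 'I_n | i \notin D}}|)%N.
  by rewrite c2 cI; lia.
have alN : (15%:R / 16%:R) ^+ (#|{: {i : 'I_n | i \notin D}}| - #|{: bool * {i : 'I_n | i \in D}}|)
    * N%:R <= 1 :> R.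
  rewrite c2 cI (_ : (n - d - 2 * d = n - 3 * d)%N); last by lia.
  by apply: le_trans lazyQ; apply: ler_wpM2l; rewrite ?exprn_ge0 ?divr_ge0 ?ler0n.
have := avg_rich_le (cP j.+1) epsE m4 th0 decN JI alN.
rewrite card_notin_in cJ cI; set b := (X in _ <= X) => h.
have {h} : avg (fun v : {ffun 'I_n -> 'I_N} => (rich R L D N (fun i => (v i)%:Z))%:R) <= b.
  apply: le_trans h; rewrite -avg_ffun_split; apply: ler_avg => v; apply: ler_ind => /andP[/forallP vD kv].
  apply/andP; split.
    by apply/forallP => i; rewrite ffunE; have := vD (val i); rewrite (valP i).
  rewrite (@lazy_kill_eqmod _ _ _ N _ (fun i => (v (val i))%:Z) _ (fun i => (v (val i))%:Z)) //.
    by move=> i; rewrite ffunE subrr dvdz0.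
  by move=> i; rewrite ffunE subrr dvdz0.
move/le_trans; apply; rewrite /b /rich_bound; apply: lerD.
  apply: ler_wpM2r; first by rewrite exprn_ge0 ?divr_ge0 ?ler0n.
  by apply: ler_wpM2r; rewrite ?exprn_ge0.
rewrite -exprMn [N%:R * _]mulrC divfK ?gt_eqF // ler_wpM2r ?invr_ge0 ?exprn_ge0 ?ler0n //.
by apply: ler_weXn2l; rewrite ?ler1n // leq_subr.
Qed.

(** The factors are 2^n for D, [J] for the exponent, at most [Q] for t, and N^n [rich_bound] for the
    number of rich v. The N^n cancels against the probability (3 L / N)^n of each solution. *)
Lemma sym_bad_rich_le :
  sym_avg (fun B => (bad_rich R d J L w B)%:R) <=
  2%:R ^+ n * J%:R * (Q%:R * (3%:R * L%:R) ^+ n * rich_bound).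
Proof.
have Lr0 : 0 < L%:R :> R by rewrite ltr0n.
have Q0 : 0 <= Q%:R :> R by rewrite ler0n.
have rb0 : 0 <= rich_bound.
  by rewrite addr_ge0 // ?divr_ge0 ?mulr_ge0 ?exprn_ge0 ?divr_ge0 ?ler0n.
set T := Q%:R * _ * _.
have T0 : 0 <= T by rewrite !mulr_ge0 // exprn_ge0 // mulr_ge0 // ltW.
pose P D (j : 'I_J) (v : {ffun 'I_n -> 'I_(3 ^ j.+1)}) : bool :=
  rich R L D (3 ^ j.+1) (fun i => (v i)%:Z) &&
   (kill_prob R D (3 ^ j.+1) (fun i => (v i)%:Z) < (3%:R * L%:R / (3 ^ j.+1)%:R) ^+ n).
apply: le_trans (_ : sym_avg (fun B => \sum_(D : {set 'I_n}) \sum_(j : 'I_J)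
   \sum_(v : {ffun 'I_n -> 'I_(3 ^ j.+1)}) \sum_(t : 'I_(3 ^ j.+1))
   (#|D| == d)%:R * ((P D j v)%:R * (kernel_eq (3 ^ j.+1) w (fun i => (v i)%:Z) t%:Z B)%:R)) <= _).
  apply: ler_sym_avg => B _; apply: le_trans (ind_exists_le _ _) _; apply: ler_sum => D _.
  case: eqP => _; last by rewrite big1 // => j _; rewrite big1 // => v _; rewrite big1 // => t _; rewrite mul0r.
  apply: le_trans (ind_exists_le _ _) _; apply: ler_sum => j _.
  apply: le_trans (ind_exists_le _ _) _; apply: ler_sum => v _.
  apply: le_trans (ind_exists_le _ _) _; apply: ler_sum => t _.
  by rewrite mul1r -ind_and.
rewrite sym_avg_sum.
apply: le_trans (_ : \sum_(D : {set 'I_n}) \sum_(j : 'I_J) T <= _); last first.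
  rewrite !sumr_const -[#|{set 'I_n}|]cardsT -powersetT card_powerset cardsT !card_ord.
  rewrite -[T *+ J]mulr_natl -[_ *+ (2 ^ n)%N]mulr_natl natrX mulrA //.
apply: ler_sum => D _; rewrite sym_avg_sum; apply: ler_sum => j _.
have [Dd|_] := eqVneq #|D| d; last first.
  by rewrite sym_avg_le // => B _; rewrite big1 // => v _; rewrite big1 // => t _; rewrite mul0r.
set N := (3 ^ j.+1)%N.
have N0 : (0 < N)%N by rewrite expn_gt0.
have Nr0 : 0 < N%:R :> R by rewrite ltr0n.
have NQ : N%:R <= Q%:R :> R by rewrite ler_nat leq_exp2l.
have Nodd : odd N by rewrite oddX orbT.
rewrite sym_avg_sum.
apply: le_trans (_ : \sum_(v : {ffun 'I_n -> 'I_N})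
    (N%:R * (3%:R * L%:R / N%:R) ^+ n) * (rich R L D N (fun i => (v i)%:Z))%:R <= _).
  apply: ler_sum => v _; rewrite sym_avg_sum.
  apply: le_trans (_ : \sum_(t : 'I_N) (3%:R * L%:R / N%:R) ^+ n * (rich R L D N (fun i => (v i)%:Z))%:R <= _); last first.
    by rewrite sumr_const card_ord -[_ *+ N]mulr_natl mulrA.
  apply: ler_sum => t _; rewrite !sym_avgMl mul1r /P.
  case: andP => [[-> kv]|_]; last first.
    by rewrite mul0r mulr_ge0 ?ler0n // exprn_ge0 // divr_ge0 ?mulr_ge0 ?ler0n.
  rewrite mul1r mulr1; apply: le_trans (ltW kv).
  exact: (sym_kernel_eq_le w D _ _ (cP j.+1) Nodd).
rewrite -mulr_sumr.
have := avg_rich_set_le Dd (ltn_ord j); rewrite /avg card_ffun !card_ord natrX -/N.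
rewrite mulrC ler_pdivrMr ?exprn_gt0 // => h.
apply: le_trans (ler_wpM2l _ h) _.
  by rewrite mulr_ge0 ?exprn_ge0 ?divr_ge0 ?mulr_ge0 ?ler0n.
rewrite (_ : _ * _ = N%:R * (3%:R * L%:R) ^+ n * rich_bound).
  by apply: ler_wpM2r => //; apply: ler_wpM2r => //; rewrite exprn_ge0 // mulr_ge0 // ltW.
by rewrite expr_div_n; field; rewrite expf_neq0 // gt_eqF.
Qed.

End RichCount.

(** * Bordering a symmetric matrix *)

(** The new row raises the rank by one. By symmetry [x^T] is not in the column space of [A] either,
    so the new column raises it once more. *)
Lemma mxrank_border (F : fieldType) n (A : 'M[F]_n) (x : 'rV_n) (a : 'M_1) :
  A^T = A -> ~~ (x <= A)%MS -> ((\rank A).+2 <= \rank (block_mx a x x^T A))%N.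
Proof.
move=> AT xA.
have add_row m (B : 'M[F]_(m, n)) (y : 'rV_n) : ~~ (y <= B)%MS -> (\rank B < \rank (col_mx y B))%N.
  move=> yB; rewrite -addsmxE; apply: rank_ltmx; rewrite ltmxE addsmxSr /=.
  by apply: contra yB => /(submx_trans (addsmxSl _ _)).
have h1 := add_row _ _ _ xA.
apply: (leq_ltn_trans h1); rewrite block_mxEh -mxrank_tr -[X in (_ < X)%N]mxrank_tr tr_row_mx.
rewrite -addsmxE; apply: rank_ltmx; rewrite ltmxE addsmxSr /=.
apply: contra xA => /(submx_trans (addsmxSl _ _)) /submxP[z].
rewrite !tr_col_mx trmxK mul_mx_row AT => /eq_row_mx[_ ->].
exact: submxMl.
Qed.

Definition ratmx n (B : 'M[bool]_n) : 'M[rat]_n := map_mx intr (signmx B).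

Definition sgn_row n (X : {ffun 'I_n -> bool}) : 'rV[rat]_n := \row_i (sgn (X i))%:~R.

Definition border n (a : bool) (X : {ffun 'I_n -> bool}) (B : 'M[bool]_n) : 'M[bool]_(1 + n) :=
  block_mx (const_mx a) (\row_i X i) (\row_i X i)^T B.

Lemma ratmx_sym n (B : 'M[bool]_n) : B \in sym_sign n -> (ratmx B)^T = ratmx B.
Proof. by move=> Bs; apply/matrixP => i j; rewrite !mxE (symP _ _ Bs). Qed.

Lemma ratmx_border n a X (B : 'M[bool]_n) :
  ratmx (border a X B) = block_mx (sgn a)%:~R%:M (sgn_row X) (sgn_row X)^T (ratmx B).
Proof.
apply/matrixP => i j; rewrite !mxE.
by case: splitP => i' _; rewrite !mxE; case: splitP => j' _; rewrite !mxE // !ord1 eqxx.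
Qed.

Lemma det_ratmx n (B : 'M[bool]_n) : (\det (ratmx B) == 0) = (\det (signmx B) == 0).
Proof. by rewrite det_map_mx intr_eq0. Qed.

Lemma rank_ratmx n (B : 'M[bool]_n) : (\rank (ratmx B) < n)%N = (\det (signmx B) == 0).
Proof.
by rewrite -det_ratmx ltn_neqAle rank_leq_row andbT -[_ == n]/(row_free _) row_free_unit unitmxE unitfE negbK.
Qed.

Lemma sym_avg_border (R : realFieldType) n (F : 'M[bool]_(1 + n) -> R) :
  sym_avg F = sym_avg (fun B : 'M[bool]_n => avg (fun X => avg (fun a => F (border a X B)))).
Proof.
pose h (p : 'M[bool]_n * (bool * {ffun 'I_n -> bool})) : 'M[bool]_(1 + n) := border p.2.1 p.2.2 p.1.
pose h' (B : 'M[bool]_(1 + n)) : 'M[bool]_n * (bool * {ffun 'I_n -> bool}) :=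
  (drsubmx B, (ulsubmx B 0 0, [ffun i => ursubmx B 0 i])).
have hK : cancel h h'.
  case=> B [a X]; rewrite /h /h' /border /= block_mxKdr block_mxKul block_mxKur mxE.
  by congr (_, (_, _)); apply/ffunP => i; rewrite ffunE mxE.
have hs p : (h p \in sym_sign (1 + n)) = (p.1 \in sym_sign n).
  rewrite !inE /h /border tr_block_mx trmxK trmx_const.
  by apply/eqP/eqP => [/eq_block_mx[]|->].
have SE : sym_sign (1 + n) = [set h p | p in setX (sym_sign n) setT].
  apply/setP => B; apply/idP/imsetP => [Bs|[p]]; last first.
    by rewrite inE => /andP[ps _] ->; rewrite hs.
  have BE : B = h (h' B).
    rewrite /h /h' /border /= -{1}(submxK B).
    move: Bs; rewrite inE -{1 2}(submxK B) tr_block_mx => /eqP/eq_block_mx[_ _ <- _].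
    by congr block_mx; apply/matrixP => i k; rewrite !mxE ?ord1 ?ffunE ?mxE.
  have := hs (h' B); rewrite -BE Bs => e; exists (h' B) => //.
  by rewrite in_setX in_setT andbT; apply/esym/e.
rewrite /sym_avg SE card_imset; last exact: can_inj hK.
rewrite big_imset /=; last by move=> p q _ _; apply: (can_inj hK).
rewrite cardsX cardsT natrM invfM -mulrA; congr (_ * _).
rewrite (eq_bigl (fun p => (p.1 \in sym_sign n) && true)); last by move=> p; rewrite !inE.
rewrite -(pair_big (mem (sym_sign n)) xpredT (fun B q => F (h (B, q)))) /= mulr_sumr.
apply: eq_bigr => B _; rewrite avg_avgC -(avg_pair (fun q => F (h (B, q)))) /avg.
by [].
Qed.

(** The Schur complement of [ratmx B] vanishes: a kernel vector of the bordered matrix has a nonzero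
    first coordinate, by which the relation can be divided. *)
Lemma border_det0 n a X (B : 'M[bool]_n) :
  \det (signmx (border a X B)) = 0 -> \det (signmx B) != 0 ->
  (sgn_row X *m invmx (ratmx B) *m (sgn_row X)^T) 0 0 = (sgn a)%:~R.
Proof.
move=> /eqP; rewrite -det_ratmx ratmx_border => /det0P[z z0 zB] detB.
have Bu : ratmx B \in unitmx by rewrite unitmxE unitfE det_ratmx.
move: z0 zB; rewrite -[z]hsubmxK; move: (lsubmx z) (rsubmx z) => z1 z2.
rewrite mul_row_block -row_mx0 => z0 /eq_row_mx[e1 e2].
have z2E : z2 = - (z1 *m sgn_row X *m invmx (ratmx B)).
  have -> : z1 *m sgn_row X = - (z2 *m ratmx B) by apply/eqP; rewrite -addr_eq0 e2.
  by rewrite mulNmx opprK mulmxK.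
have z10 : z1 0 0 != 0.
  apply: contra z0 => /eqP z10; have -> : z1 = 0 by apply/matrixP => i j; rewrite !ord1 z10 mxE.
  by rewrite z2E (_ : z1 = 0) ?mul0mx ?oppr0 ?row_mx0 //; apply/matrixP => i j; rewrite !ord1 z10 mxE.
move: e1; rewrite z2E mulNmx -!mulmxA => /eqP; rewrite subr_eq0 => /eqP.
rewrite [z1]mx11_scalar !mul_scalar_mx => /(scalerI z10)/matrixP/(_ 0 0) <-.
by rewrite mxE eqxx.
Qed.

(** * One step of the rank growth *)

(** As long as 3 divides all of v, it divides t w and hence t, because w has an entry that is 1 or
    -1 or because t = 0. Dividing both by 3 decreases a nonzero entry of v. *)
Lemma primitive_solution n (A : 'I_n -> 'I_n -> int) (w v : 'I_n -> int) t :
  (exists i, v i != 0) -> (exists i, `|w i| == 1) \/ t = 0 ->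
  (forall a, \sum_b A a b * v b = t * w a) ->
  exists v' t' k, [/\ exists i, ~~ (3 %| v' i)%Z, forall a, \sum_b A a b * v' b = t' * w a,
    forall i, v i = 3%:Z ^+ k * v' i & t = 3%:Z ^+ k * t'].
Proof.
move=> [i0]; move: {2}`|v i0|%N (leqnn `|v i0|%N) => h; elim: h v t => [|h IH] v t vh v0 wt Av.
  by move: vh v0; rewrite leqn0 absz_eq0 => ->.
have [/existsP[i vi]|] := boolP [exists i, ~~ (3 %| v i)%Z].
  by exists v, t, 0%N; split; [exists i| |move=> j|]; rewrite ?expr0 ?mul1r.
rewrite negb_exists => /forallP v3.
have vE i : v i = 3%:Z * (v i %/ 3)%Z by rewrite mulrC divzK //; have := v3 i; rewrite negbK.
have t3 : (3 %| t)%Z.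
  case: wt => [[i wi]|->]; last exact: dvdz0.
  have : (3 %| t * w i)%Z.
    by rewrite -Av; apply: rpred_sum => b _; rewrite dvdz_mull // vE dvdz_mulr.
  by rewrite mulrC Gauss_dvdzr // coprimezE (eqP (_ : `|w i|%N == 1%N)) //; move: wi; rewrite -abszE.
have tE : t = 3%:Z * (t %/ 3)%Z by rewrite mulrC divzK.
have [|||a|v' [t' [k [p e vk tk]]]] := IH (fun i => (v i %/ 3)%Z) (t %/ 3)%Z.
- by move: vh v0; rewrite {1 2}vE abszM; lia.
- by apply: contra v0 => /eqP h0; rewrite vE h0 mulr0.
- by case: wt => [wi|t0]; [left|right; rewrite t0 div0z].
- have : 3%:Z != 0 by [].
  move/mulfI; apply; rewrite mulrA -tE -Av mulr_sumr; apply: eq_bigr => b _.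
  by rewrite [in RHS]vE; ring.
exists v', t', k.+1; split => // [i|].
  by rewrite vE vk exprS mulrA.
by rewrite tE tk exprS mulrA.
Qed.

(** The exceptional set may depend on [w] but serves all [v], [t] and [s] at once, so v may be
    chosen as a function of the matrix. *)
Definition small_ball (R : realFieldType) n (J : nat) (q r : R) : Prop :=
  forall w : 'I_n -> int, exists bad : pred 'M[bool]_n,
    sym_avg (fun B => (bad B)%:R) <= q /\
    forall B, ~~ bad B -> forall v t, (exists i, ~~ (3 %| v i)%Z) ->
      (forall a, \sum_b signmx B a b * v b = t * w a) ->
      forall s, avg (fun e : {ffun 'I_n -> bool} =>
        ((3 ^ J)%N %| (\sum_i sgn (e i) * v i) - s)%Z%:R) <= r.

Section Step.
Variables (R : realFieldType) (n J : nat) (q r : R).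
Hypothesis q0 : 0 <= q.
Hypothesis r0 : 0 <= r.
Hypothesis sb : small_ball n J q r.
Local Notation sgns := {ffun 'I_n -> bool}.

(** A row in the row space is orthogonal to every kernel vector. A kernel vector made primitive at 3
    is a solution for w = 0, so its atom at 0 is at most [r]. *)
Lemma singular_step :
  sym_avg (fun B : 'M[bool]_n => avg (fun X : sgns =>
    ((\det (signmx B) == 0) && (sgn_row X <= ratmx B)%MS)%:R)) <= q + r.
Proof.
have [bad [bad_q bad_r]] := sb (fun=> 0).
apply: le_trans (_ : sym_avg (fun B => (bad B)%:R + r) <= _); last first.
  by rewrite sym_avgD sym_avg_const lerD2r.
apply: ler_sym_avg => B Bs; have [bB|gB] := boolP (bad B).
  rewrite -[leLHS]addr0; apply: lerD r0; apply: avg_le_bound => // X.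
  by rewrite lern1 leq_b1.
rewrite add0r; have [/eqP/eqP/det0P[z z0 zB]|_] := boolP (\det (signmx B) == 0); last exact: avg_le_bound.
have zE a : \sum_b signmx B a b * z 0 b = 0 * 0.
  rewrite mul0r; move/matrixP/(_ 0 a): zB; rewrite !mxE => e; rewrite -[RHS]e.
  by apply: eq_bigr => b _; rewrite mulrC !signmxE (symP _ _ Bs).
have [i zi] : exists i, z 0 i != 0.
  by apply/existsP; rewrite -negb_forall; apply: contra z0 => /forallP h; apply/eqP/rowP => i; rewrite mxE; apply/eqP.
have [v [t [k [vp _ vk _]]]] := @primitive_solution _ _ (fun=> 0) (fun i => z 0 i) 0 (ex_intro _ i zi) (or_intror erefl) zE.
have vE a : \sum_b signmx B a b * v b = 0 * 0.
  have h3 : 3%:Z ^+ k != 0 by rewrite expf_neq0.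
  rewrite mul0r; apply: (mulfI h3); rewrite mulr0 -[RHS](zE a) mulr_sumr.
  by apply: eq_bigr => b _; rewrite vk mulrCA.
apply: le_trans (bad_r B gB v 0 vp vE 0); apply: ler_avg => X; apply: ler_ind => /submxP[u uE].
rewrite (_ : \sum_i _ = 0) ?subrr ?dvdz0 //.
apply/eqP; rewrite -(intr_eq0 rat) rmorph_sum; apply/eqP.
pose vr : 'cV[rat]_n := \col_i (v i)%:~R.
have vr0 : ratmx B *m vr = 0.
  apply/colP => a; rewrite !mxE; transitivity ((\sum_b signmx B a b * v b)%:~R : rat).
    by rewrite rmorph_sum; apply: eq_bigr => b _; rewrite !mxE rmorphM.
  by rewrite vE.
have : sgn_row X *m vr = 0 by rewrite uE -mulmxA vr0 mulmx0.
move/matrixP/(_ 0 0); rewrite !mxE => e; rewrite -[RHS]e.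
by apply: eq_bigr => b _; rewrite !mxE rmorphM.
Qed.

Definition flip_on (K : {set 'I_n}) (X : sgns) : sgns := [ffun i => X i (+) (i \in K)].

Definition quad_hit (e : rat) (B : 'M[bool]_n) (X : sgns) : bool :=
  (\det (signmx B) != 0) &&
  ((sgn_row X *m invmx (ratmx B) *m (sgn_row X)^T) 0 0 == e).

Definition part (K : {set 'I_n}) (X : sgns) : 'rV[rat]_n :=
  \row_i (if i \in K then (sgn (X i))%:~R else 0).

(** Write X = v + u with u supported on [K]. The flip gives v - u, and the two values of the
    quadratic form differ by four times the bilinear form at (u, v). *)
Lemma quad_hit_flip e B X K : B \in sym_sign n -> quad_hit e B X -> quad_hit e B (flip_on K X) ->
  (part K X *m invmx (ratmx B) *m (part (~: K) X)^T) 0 0 = 0.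
Proof.
move=> Bs /andP[_ /eqP h1] /andP[_ /eqP h2]; move: h1 h2.
have -> : sgn_row X = part (~: K) X + 1 *: part K X.
  by apply/rowP => i; rewrite !mxE inE; case: (i \in K); rewrite /= ?mul1r ?add0r ?mulr0 ?addr0.
have -> : sgn_row (flip_on K X) = part (~: K) X + (-1) *: part K X.
  apply/rowP => i; rewrite !mxE inE ffunE; case: (i \in K).
    by rewrite addbT add0r mulN1r; case: (X i).
  by rewrite addbF mulr0 addr0.
set u := part K X; set v := part _ X; set Z := invmx _.
have ZT : Z^T = Z by rewrite /Z trmx_inv ratmx_sym.
pose bil (x y : 'rV[rat]_n) : rat := (x *m Z *m y^T) 0 0.
have bilC x y : bil x y = bil y x.
  rewrite /bil -[in LHS](trmxK (x *m Z *m y^T)) [LHS]mxE.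
  by rewrite !trmx_mul trmxK ZT mulmxA.
have bilE s : ((v + s *: u) *m Z *m (v + s *: u)^T) 0 0 = bil v v + s * (bil v u + bil u v) + s ^+ 2 * bil u u.
  rewrite linearD linearZ /= !mulmxDl !mulmxDr -!scalemxAl -!scalemxAr /bil !mxE.
  by ring.
by rewrite !bilE (bilC v u) /bil; lra.
Qed.

(** Decoupling: the signs in [K] become the right-hand side w, and v proportional to the inverse of
    [B] applied to w is orthogonal to the signs outside [K]. The full signed sum of v then equals
    its part on [K], which takes at most 2^#|K| values. *)
Lemma quad_flip_le e (K : {set 'I_n}) : K != set0 ->
  sym_avg (fun B => avg (fun X => (quad_hit e B X && quad_hit e B (flip_on K X))%:R)) <=
  q + 2%:R ^+ #|K| * r.
Proof.
move=> /set0Pn[i0 i0K].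
pose h B (X X' : sgns) := (\det (signmx B) != 0) &&
  ((part K X *m invmx (ratmx B) *m (part (~: K) X')^T) 0 0 == 0).
apply: le_trans (_ : sym_avg (fun B => avg (fun X => avg (fun X' => (h B X X')%:R))) <= _).
  apply: ler_sym_avg => B Bs; rewrite -(avg_merge (mem K)).
  apply: ler_avg => X; apply: ler_avg => X'; apply: ler_ind => /andP[h1 h2].
  have := quad_hit_flip Bs h1 h2; case/andP: h1 => detB _; rewrite /h detB /=.
  have -> : part K (merge (mem K) X X') = part K X.
    by apply/rowP => i; rewrite !mxE ffunE /=; case: (i \in K).
  have -> : part (~: K) (merge (mem K) X X') = part (~: K) X'.
    by apply/rowP => i; rewrite !mxE ffunE inE /=; case: (i \in K).
  by move=> ->.
rewrite sym_avg_avg; apply: avg_le_bound => [|X].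
  by rewrite addr_ge0 // mulr_ge0 ?exprn_ge0.
pose w i := if i \in K then sgn (X i) else 0.
have [bad [bad_q bad_r]] := sb w.
apply: le_trans (_ : sym_avg (fun B => (bad B)%:R + 2%:R ^+ #|K| * r) <= _); last first.
  by rewrite sym_avgD sym_avg_const lerD2r.
have r2 : 0 <= 2%:R ^+ #|K| * r by rewrite mulr_ge0 ?exprn_ge0.
apply: ler_sym_avg => B Bs; have [bB|gB] := boolP (bad B).
  rewrite -[leLHS]addr0; apply: lerD r2; apply: avg_le_bound => // X'.
  by rewrite lern1 leq_b1.
rewrite add0r; have [detB|] := boolP (\det (signmx B) != 0); last first.
  by move=> /negbTE dB; apply: avg_le_bound => // X'; rewrite /h dB.
(* The adjugate gives an integral multiple of the solution, with t equal to the determinant. *)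
pose wc : 'cV[int]_n := \col_i w i; pose z := \adj (signmx B) *m wc.
have zE a : \sum_b signmx B a b * z b 0 = \det (signmx B) * w a.
  have : signmx B *m z = \det (signmx B) *: wc by rewrite mulmxA mul_mx_adj mul_scalar_mx.
  by move/matrixP/(_ a 0); rewrite !mxE.
have wi0 : `|w i0| == 1 by rewrite /w i0K; case: (X i0).
have [i zi] : exists i, z i 0 != 0.
  apply/existsP; rewrite -negb_forall; apply/negP => /forallP zz.
  have := zE i0; rewrite big1 => [/esym/eqP|b _]; last by rewrite (eqP (zz b)) mulr0.
  by rewrite mulf_eq0 (negbTE detB) /= => /eqP w0; move: wi0; rewrite w0.
have [v [t [k [vp vE _ tk]]]] := @primitive_solution _ _ w (fun i => z i 0) _ (ex_intro _ i zi)
  (or_introl (ex_intro _ i0 wi0)) zE.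
have t0 : t != 0 by apply: contra detB => /eqP t0; rewrite tk t0 mulr0.
pose s (P : {set 'I_n}) := \sum_(i in K) sgn (i \in P) * v i.
apply: le_trans (_ : avg (fun X' : sgns => \sum_(P in powerset K)
   ((3 ^ J)%N %| (\sum_i sgn (X' i) * v i) - s P)%Z%:R) <= _); last first.
  rewrite avg_sum; apply: le_trans (_ : \sum_(P in powerset K) r <= _).
    by apply: ler_sum => P _; apply: (bad_r B gB v t vp vE).
  by rewrite sumr_const card_powerset -[r *+ _]mulr_natl natrX.
apply: ler_avg => X'; case hX: (h _ _ _); last by apply: sumr_ge0 => P _; rewrite ler0n.
pose P := [set i in K | X' i].
have PK : P \in powerset K by rewrite inE; apply/subsetP => j; rewrite inE => /andP[].
rewrite (bigD1 P) //= (_ : (\sum_i sgn (X' i) * v i) - s P = 0); last first.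
  rewrite (bigID (mem K)) /= /s addrAC [X in X + _](_ : _ = 0) ?add0r; last first.
    by rewrite -sumrB big1 // => j jK; rewrite /P !inE jK /= subrr.
  have Bu : ratmx B \in unitmx by rewrite unitmxE unitfE det_ratmx.
  pose vr : 'cV[rat]_n := \col_i (v i)%:~R.
  have Bv : ratmx B *m vr = t%:~R *: (part K X)^T.
    apply/colP => a; rewrite !mxE; transitivity ((\sum_b signmx B a b * v b)%:~R : rat).
      by rewrite rmorph_sum; apply: eq_bigr => b _; rewrite !mxE rmorphM.
    by rewrite vE rmorphM /w; case: ifP.
  have vrE : vr = t%:~R *: (invmx (ratmx B) *m (part K X)^T).
    by rewrite -[vr](mulKmx Bu) Bv scalemxAr.
  have : (part (~: K) X' *m vr) 0 0 = 0.
    rewrite vrE -scalemxAr mxE; apply/eqP; rewrite mulf_eq0; apply/orP; right; apply/eqP.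
    transitivity ((part (~: K) X' *m (invmx (ratmx B) *m (part K X)^T))^T 0 0); first by rewrite [RHS]mxE.
    rewrite !trmx_mul !trmxK trmx_inv ratmx_sym //.
    by apply/eqP; case/andP: hX.
  rewrite mxE => /eqP; rewrite (bigID (mem K)) /= big1 ?add0r; last first.
    by move=> j jK; rewrite mxE inE jK mul0r.
  move=> e0; apply/eqP; rewrite -(intr_eq0 rat) rmorph_sum; apply/eqP; rewrite -[RHS](eqP e0).
  by apply: eq_bigr => j jK; rewrite !mxE inE jK rmorphM.
by rewrite dvdz0 lerDl; apply: sumr_ge0 => P' _; rewrite ler0n.
Qed.

Lemma sym_avg_sqr_le (f : 'M[bool]_n -> R) : sym_avg f ^+ 2 <= sym_avg (fun B => f B ^+ 2).
Proof.
have : 0 <= sym_avg (fun B => (f B - sym_avg f) ^+ 2) by apply: sym_avg_ge0 => B; exact: sqr_ge0.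
rewrite (_ : sym_avg _ = sym_avg (fun B => f B ^+ 2 + ((- 2 * sym_avg f) * f B + sym_avg f ^+ 2))); last first.
  by congr (_ * _); apply: eq_bigr => B _; ring.
rewrite sym_avgD sym_avgD sym_avgMl sym_avg_const; lra.
Qed.

(** The flips inside [S] form a group preserving the uniform law. Cauchy-Schwarz is applied to the
    average over an orbit, and the product of two flips is again a flip. *)
Lemma avg_flip_sqr_le (S : {set 'I_n}) (g : sgns -> R) :
  avg g ^+ 2 <= avg (fun k : sgns => avg (fun X => g X * g (flip_on [set i in S | k i] X))).
Proof.
pose act (k X : sgns) := flip_on [set i in S | k i] X.
have actE k X i : act k X i = X i (+) ((i \in S) && k i) by rewrite ffunE inE.
have actK k : involutive (act k).
  by move=> X; apply/ffunP => i; rewrite !actE addbK.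
pose add (k k' : sgns) : sgns := [ffun i => k i (+) k' i].
have addK k : involutive (add k) by move=> k'; apply/ffunP => i; rewrite !ffunE addKb.
have act_act k k' X : act k' (act k X) = act (add k k') X.
  by apply/ffunP => i; rewrite !actE ffunE; case: (i \in S) => /=; rewrite ?addbF ?addbA.
have K0 : (0 < #|{: sgns}|)%N by rewrite card_ffun card_bool expn_gt0.
have gE : avg g = avg (fun X => avg (fun k => g (act k X))).
  rewrite avg_avgC -[LHS](avg_const _ K0); apply: eq_avg => k.
  by rewrite -(avg_bij g (inv_bij (actK k))).
rewrite gE; apply: le_trans (avg_sqr_le _) _; rewrite le_eqVlt; apply/orP; left; apply/eqP.
rewrite (eq_avg (g := fun X => avg (fun k => avg (fun k' => g (act k X) * g (act k' X))))); last first.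
  by move=> X; rewrite expr2 -avgMr; apply: eq_avg => k; rewrite avgMl.
rewrite avg_avgC -[RHS](avg_const _ K0); apply: eq_avg => k.
rewrite avg_avgC -(avg_bij _ (inv_bij (addK k))); apply: eq_avg => k' /=.
rewrite -(avg_bij _ (inv_bij (actK k))); apply: eq_avg => X /=.
by rewrite actK act_act addK.
Qed.

Lemma quad_step e (s : nat) : (s <= n)%N ->
  sym_avg (fun B => avg (fun X => (quad_hit e B X)%:R)) ^+ 2 <=
  2%:R^-1 ^+ s + (q + 2%:R ^+ s * r).
Proof.
move=> sn; pose S := [set widen_ord sn i | i : 'I_s].
have cS : #|S| = s.
  by rewrite card_imset ?card_ord // => i j /(congr1 val) /= /val_inj.
apply: le_trans (sym_avg_sqr_le _) _.
apply: le_trans (_ : sym_avg (fun B => avg (fun k : sgns => avg (fun X =>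
   (quad_hit e B X && quad_hit e B (flip_on [set i in S | k i] X))%:R))) <= _).
  apply: ler_sym_avg => B _; apply: le_trans (avg_flip_sqr_le S _) _.
  by apply: ler_avg => k; apply: ler_avg => X; rewrite ind_and.
rewrite sym_avg_avg.
have K0 : (0 < #|{: sgns}|)%N by rewrite card_ffun card_bool expn_gt0.
pose a0 : sgns := [ffun=> false].
have := avg_ind_eq R (mem S) a0; rewrite card_bool cS => <-.
rewrite -[X in _ + X](avg_const _ K0) -avgD; apply: ler_avg => k.
have qr0 : 0 <= q + 2%:R ^+ s * r by rewrite addr_ge0 // mulr_ge0 ?exprn_ge0.
(* The random subset of [S] is empty with probability 2^-s; only then does the flip carry no
   information. *)
have [K0E|Kn] := eqVneq [set i in S | k i] set0.
  rewrite (_ : [forall _, _] = true); last first.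
    apply/forallP => i; apply/implyP => /= iS; rewrite ffunE; apply/eqP/negbTE/negP => ki.
    by move/setP/(_ i): K0E; rewrite !inE ki andbT => iS'; move: (iS : i \in S); rewrite iS'.
  apply: le_trans (_ : 1 <= _); last by rewrite lerDl.
  by rewrite sym_avg_le // => B _; apply: avg_le_bound => // X; rewrite lern1 leq_b1.
apply: le_trans (quad_flip_le e Kn) _; apply: ler_wpDl; first by rewrite ler0n.
rewrite lerD2l; apply: ler_wpM2r => //; apply: ler_weXn2l; rewrite ?ler1n //.
by rewrite -cS subset_leq_card //; apply/subsetP => i; rewrite inE => /andP[].
Qed.

End Step.

(** * Corank of growing leading minors *)

Definition sing_prob (R : realFieldType) n : R :=
  sym_avg (fun B : 'M[bool]_n => (\det (signmx B) == 0)%:R).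

Definition corank_prob (R : realFieldType) n (k : nat) : R :=
  sym_avg (fun B : 'M[bool]_n => (\rank (ratmx B) + k <= n)%N%:R).

Lemma sing_probE (R : realFieldType) n : sing_prob R n = corank_prob R n 1.
Proof. by congr (_ * _); apply: eq_bigr => B _; rewrite addn1 rank_ratmx. Qed.

(** Three cases for a singular bordered matrix: [B] is singular and the new row lies in its row
    space; [B] is singular and the row does not, so the rank grows by two and [B] had corank at
    least k + 1; or [B] is invertible and the quadratic form hits the corner entry. *)
Lemma corank_step (R : realFieldType) n J (q r E : R) s k :
  0 <= q -> 0 <= r -> 0 <= E -> small_ball n J q r -> (s <= n)%N ->
  2%:R^-1 ^+ s + (q + 2%:R ^+ s * r) <= E ^+ 2 -> (0 < k)%N ->
  corank_prob R n.+1 k <= corank_prob R n k.+1 + (q + r + E).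
Proof.
move=> q0 r0 E0 sb sn qE k0; rewrite /corank_prob (@sym_avg_border R n).
apply: le_trans (_ : sym_avg (fun B : 'M[bool]_n => (\rank (ratmx B) + k.+1 <= n)%N%:R +
   (avg (fun X => ((\det (signmx B) == 0) && (sgn_row X <= ratmx B)%MS)%:R) +
    avg (fun X => avg (fun a : bool => (quad_hit (sgn a)%:~R B X)%:R)))) <= _); last first.
  rewrite !sym_avgD lerD2l; apply: lerD; first exact: singular_step sb.
  rewrite (_ : sym_avg _ = avg (fun a : bool => sym_avg (fun B : 'M[bool]_n =>
     avg (fun X => (quad_hit (sgn a)%:~R B X)%:R)))); last first.
    by rewrite -sym_avg_avg; congr (_ * _); apply: eq_bigr => B _; rewrite avg_avgC.
  apply: avg_le_bound => // a.
  rewrite -(@ler_pXn2r _ 2) ?nnegrE //.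
    by apply: le_trans (quad_step q0 r0 sb _ sn) qE.
  by apply: sym_avg_ge0 => B; apply: avg_ge0 => X; rewrite ler0n.
apply: ler_sym_avg => B Bs.
have X0 : (0 < #|{ffun 'I_n -> bool}|)%N by rewrite card_ffun card_bool expn_gt0.
have b0 : (0 < #|{: bool}|)%N by rewrite card_bool.
rewrite -[X in _ <= X + _](avg_const _ X0) -!avgD; apply: ler_avg => X.
rewrite -[X in _ <= X + _](avg_const _ b0) -[X in _ <= _ + (X + _)](avg_const _ b0) -!avgD.
apply: ler_avg => a; case: leqP => [rk|_]; last by rewrite !addr_ge0 ?ler0n.
have le1 (x y : R) : 0 <= y -> x <= x + y by move=> ?; rewrite lerDl.
have [dB|dB] := boolP (\det (signmx B) == 0).
  have [xB|xB] := boolP (sgn_row X <= ratmx B)%MS.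
    by rewrite addrCA; apply: le1; rewrite addr_ge0 ?ler0n.
  have := mxrank_border (sgn a)%:~R%:M (ratmx_sym Bs) xB; rewrite -ratmx_border => rk2.
  have -> : (\rank (ratmx B) + k.+1 <= n)%N by have := leq_trans (leq_add rk2 (leqnn k)) rk; lia.
  by apply: le1; rewrite addr_ge0 ?ler0n.
have -> : quad_hit (sgn a)%:~R B X.
  rewrite /quad_hit dB /= (border_det0 (a := a)) //; apply/eqP; rewrite -rank_ratmx.
  by apply: leq_trans rk; rewrite -addn1 leq_add2l.
by rewrite addrA addrC; apply: le1; rewrite addr_ge0 ?ler0n.
Qed.

Lemma corank_chain (R : realFieldType) (b : nat -> R) m l :
  (forall t k, (m <= t < m + l)%N -> (0 < k)%N ->
    corank_prob R t.+1 k <= corank_prob R t k.+1 + b t) ->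
  forall k, (0 < k)%N -> corank_prob R (m + l) k <=
    corank_prob R m (k + l) + \sum_(t < l) b (m + t)%N.
Proof.
elim: l => [|l IH] step k k0; first by rewrite addn0 big_ord0 addr0 addn0.
rewrite addnS big_ord_recr /=.
apply: le_trans (step _ _ _ k0) _; first by lia.
rewrite addrA lerD2r -addSnnS; apply: IH => // t k' tm; apply: step; lia.
Qed.

(** Going back [l] steps from corank 1 requires corank l + 1 > m at size [m], which is
    impossible. *)
Lemma sing_prob_le_sum (R : realFieldType) (b : nat -> R) m l :
  (forall t k, (m <= t < m + l)%N -> (0 < k)%N ->
    corank_prob R t.+1 k <= corank_prob R t k.+1 + b t) -> (m <= l)%N ->
  sing_prob R (m + l) <= \sum_(t < l) b (m + t)%N.
Proof.
move=> step ml; rewrite sing_probE; apply: le_trans (corank_chain step _) _ => //.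
rewrite -[leRHS]add0r lerD2r; apply: sym_avg_le => B _.
by case: leqP => // h; exfalso; move: h; rewrite leqNgt; lia.
Qed.

(** If [B] is invertible, its two borders by the all-ones row cannot both be singular, since one
    quadratic form would equal 1 and -1. This serves the finitely many small sizes. *)
Lemma sing_prob_lt1 (R : realFieldType) n : sing_prob R n < 1.
Proof.
suff [B Bs dB] : exists2 B : 'M[bool]_n, B \in sym_sign n & \det (signmx B) != 0.
  rewrite /sing_prob /sym_avg mulrC ltr_pdivrMr ?ltr0n ?sym_sign_gt0 // mul1r.
  rewrite (bigD1 B) //= (negbTE dB) add0r.
  apply: le_lt_trans (_ : \sum_(B' in sym_sign n | B' != B) 1 < _).
    by apply: ler_sum => B' _; rewrite lern1 leq_b1.
  rewrite -[X in _ < X%:R]sum1_card natr_sum [X in _ < X](bigD1 B) //=.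
  by rewrite ltrDr ltr01.
elim: n => [|n [B Bs dB]].
  by exists (const_mx true); rewrite ?inE ?trmx_const // det_mx00.
pose X : {ffun 'I_n -> bool} := [ffun=> true].
have bs a : border a X B \in sym_sign (1 + n).
  by move: Bs; rewrite !inE tr_block_mx trmxK trmx_const => /eqP ->.
have [dt|dt] := eqVneq (\det (signmx (border true X B))) 0; last by exists (border true X B).
have [df|df] := eqVneq (\det (signmx (border false X B))) 0; last by exists (border false X B).
by have := border_det0 dt dB; rewrite (border_det0 df dB).
Qed.

(** * Choice of constants *)

Lemma expr_bernoulli (R : realFieldType) (x : R) k : 0 <= x -> x <= 1 ->
  x ^+ k * (1 + k%:R * (1 - x)) <= 1.
Proof.
move=> x0 x1; elim: k => [|k IH]; first by rewrite expr0 mul0r addr0 mulr1.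
apply: le_trans IH; rewrite exprSr -mulrA; apply: ler_wpM2l; first exact: exprn_ge0.
have k0 : 0 <= k%:R :> R by [].
have h : 0 <= (1 - x) ^+ 2 * (1 + k%:R) by rewrite mulr_ge0 ?sqr_ge0 // addr_ge0.
by rewrite -[k.+1%:R]natr1; move: h; rewrite expr2; lra.
Qed.

Lemma expr_small (R : archiRealFieldType) (x y : R) : 0 <= x -> x < 1 -> 0 < y ->
  exists2 k, (0 < k)%N & x ^+ k <= y.
Proof.
move=> x0 x1 y0; pose z := y^-1 / (1 - x); pose k := (Num.bound z).+1; exists k => //.
have x10 : 0 < 1 - x by rewrite subr_gt0.
have z0 : 0 <= z by rewrite divr_ge0 // ?invr_ge0 ltW.
have zk : y^-1 <= k%:R * (1 - x).
  rewrite -ler_pdivrMr //; apply: ltW; apply: lt_trans (archi_boundP z0) _.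
  by rewrite ltr_nat.
have h := expr_bernoulli k x0 (ltW x1).
have xk : x ^+ k * y^-1 <= 1.
  apply: le_trans h; apply: ler_wpM2l; first exact: exprn_ge0.
  by apply: le_trans zk _; rewrite lerDr ler01.
by rewrite -[leRHS]mul1r -ler_pdivrMr.
Qed.

Section Constants.
Variables (R : archiRealFieldType) (c : nat -> int -> R).
Hypothesis cP : forall j, cosine_like (3 ^ j) (c j).

Lemma sparse_bound (h n : nat) : (16 * h <= n)%N ->
  3%:R * 8%:R ^+ h.*2 * (5%:R / 8%:R) ^+ n <= 3%:R * 2%:R^-1 ^+ h :> R.
Proof.
move=> hn; rewrite -mulrA; apply: ler_wpM2l => //.
apply: le_trans (_ : 8%:R ^+ h.*2 * (5%:R / 8%:R : R) ^+ (16 * h) <= _).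
  by apply: ler_wpM2l; rewrite ?exprn_ge0 //; apply: ler_wiXn2l => //; lra.
rewrite -mul2n exprM [_ ^+ (16 * h)]exprM -exprMn; apply: lerXn2r; rewrite ?nnegrE ?invr_ge0 //.
- by rewrite mulr_ge0 ?exprn_ge0 // divr_ge0.
have h4 : (5%:R / 8%:R) ^+ 4 <= 1 / 6%:R :> R by rewrite !exprS expr0; lra.
have h16 : (5%:R / 8%:R) ^+ 16 <= (1 / 6%:R) ^+ 4 :> R.
  by rewrite (exprM _ 4 4); apply: lerXn2r; rewrite ?nnegrE ?exprn_ge0 ?divr_ge0.
apply: le_trans (ler_wpM2l _ h16) _; first exact: exprn_ge0.
by rewrite !exprS !expr0; lra.
Qed.

(** Here K = 6 L collects 2 * 3 L. The value of [m] makes 16 / m equal to 1 / (36 K^16), which beats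
    K^(16 h) and leaves (2 * 9 / 36)^h; L = 480 makes 20 * 6 / L equal to 1/4, and (1/4)^(2 h) beats
    6^h. *)
Lemma rich_bound_le (K L m n h J k : nat) : L = 480%N -> K = (6 * L)%N ->
  m = (576 * K ^ 16)%N -> h = (n %/ 16)%N -> J = (h %/ k)%N ->
  2%:R ^+ n * J%:R * ((3 ^ J)%N%:R * (3%:R * L%:R) ^+ n * rich_bound R n h.*2 J L m) <=
  (K%:R ^+ 16 + 1) * 2%:R^-1 ^+ h.
Proof.
move=> LE KE mE hE JE; rewrite /rich_bound doubleK.
have Lr : L%:R = 480%:R :> R by rewrite LE.
have Kr : K%:R = 6%:R * L%:R :> R by rewrite KE natrM.
have mr : m%:R = 576%:R * K%:R ^+ 16 :> R by rewrite mE natrM natrX.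
have L0 : 0 < L%:R :> R by rewrite Lr.
have K0 : 0 < K%:R :> R by rewrite Kr mulr_gt0.
have hn : (16 * h <= n)%N by rewrite hE mulnC leq_divM.
have nh : (n <= 16 * h + 16)%N by rewrite hE; lia.
have Jh : (J <= h)%N by rewrite JE leq_div.
clear LE KE mE hE JE.
set Q : R := (3 ^ J)%N%:R.
have Q0 : 0 <= Q by rewrite ler0n.
have Qh : Q <= 3%:R ^+ h by rewrite /Q -natrX ler_nat leq_exp2l.
have J2 : J%:R <= 2%:R ^+ h :> R.
  by rewrite -natrX ler_nat (leq_trans Jh) // ltnW // ltn_expl.
have K1 : 1 <= K%:R :> R by rewrite Kr Lr; lra.
have e1 : 2%:R ^+ h.*2 * (4%:R / m%:R) ^+ h = (4%:R * (4%:R / m%:R)) ^+ h :> R.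
  by rewrite -mul2n exprM -exprMn -natrX.
have e2 : 2%:R ^+ n * (3%:R * L%:R) ^+ n = K%:R ^+ n :> R.
  by rewrite -exprMn mulrA -natrM Kr.
have e3 : 20%:R ^+ n / L%:R ^+ n ^+ 2 * K%:R ^+ n = (120%:R / L%:R) ^+ n :> R.
  rewrite -exprM [(n * 2)%N]mulnC exprM -exprVn -!exprMn; congr (_ ^+ n).
  by rewrite Kr; field; rewrite gt_eqF.
have -> : 2%:R ^+ n * J%:R * (Q * (3%:R * L%:R) ^+ n * (Q * 2%:R ^+ h.*2 * (4%:R / m%:R) ^+ h + 20%:R ^+ n / L%:R ^+ n ^+ 2)) =
   J%:R * Q ^+ 2 * K%:R ^+ n * (4%:R * (4%:R / m%:R)) ^+ h + J%:R * Q * (120%:R / L%:R) ^+ n.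
  by rewrite -e1 -e3 -e2; move: (_ / _ ^+ 2) (2%:R ^+ n) ((4%:R / m%:R) ^+ h) => x1 x2 x3; ring.
rewrite [leRHS]mulrDl mul1r; apply: lerD.
  have -> : 4%:R * (4%:R / m%:R) = (K%:R ^+ 16)^-1 / 36%:R :> R.
    by rewrite mr; field; rewrite gt_eqF.
  have Kn : K%:R ^+ n <= K%:R ^+ 16 * (K%:R ^+ 16) ^+ h :> R.
    by rewrite -exprM -exprD; apply: ler_weXn2l => //; lia.
  have Q2 : Q ^+ 2 <= 9%:R ^+ h.
    have -> : 9%:R ^+ h = (3%:R ^+ h) ^+ 2 :> R by rewrite -exprM mulnC exprM -[3%:R ^+ 2]natrX.
    by apply: lerXn2r; rewrite ?nnegrE ?exprn_ge0.
  have z0 : 0 <= ((K%:R ^+ 16)^-1 / 36%:R) ^+ h :> R.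
    by rewrite exprn_ge0 // divr_ge0 ?invr_ge0 ?exprn_ge0 // ltW.
  apply: le_trans (_ : (2%:R : R) ^+ h * 9%:R ^+ h * (K%:R ^+ 16 * (K%:R ^+ 16) ^+ h) * ((K%:R ^+ 16)^-1 / 36%:R) ^+ h <= _).
    apply: ler_wpM2r => //; apply: ler_pM; rewrite ?mulr_ge0 ?exprn_ge0 ?ler0n //.
    by apply: ler_pM; rewrite ?exprn_ge0 ?ler0n.
  rewrite le_eqVlt; apply/orP; left; apply/eqP.
  rewrite [LHS](_ : _ = K%:R ^+ 16 * (2%:R * 9%:R * K%:R ^+ 16 * ((K%:R ^+ 16)^-1 / 36%:R)) ^+ h); last first.
    by rewrite !exprMn; ring.
  congr (_ * _ ^+ h); field; by rewrite gt_eqF.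
have -> : 120%:R / L%:R = 1 / 4%:R :> R by rewrite Lr; field.
apply: le_trans (_ : (2%:R : R) ^+ h * 3%:R ^+ h * (1 / 4%:R) ^+ (2 * h) <= _).
  apply: ler_pM; rewrite ?mulr_ge0 ?exprn_ge0 ?ler0n ?divr_ge0 //.
    by apply: ler_pM; rewrite ?ler0n.
  by apply: ler_wiXn2l; [|lra|lia]; rewrite divr_ge0.
by rewrite exprM -!exprMn; apply: lerXn2r; rewrite ?nnegrE ?mulr_ge0 ?exprn_ge0 ?divr_ge0 ?invr_ge0 // expr2; lra.
Qed.

Lemma exists_small_ball : exists (C0 : R) (k : nat), [/\ 0 <= C0, (0 < k)%N &
  forall n h J, h = (n %/ 16)%N -> J = (h %/ k)%N -> (0 < n)%N ->
    small_ball n J (C0 * 2%:R^-1 ^+ h) (480%:R / (3 ^ J)%N%:R)].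
Proof.
(* The constants enter through equations, so that the unary number 576 * K^16 is never evaluated. *)
have [L LE] : exists L, L = 480%N by exists 480%N.
have [K KE] : exists K, K = (6 * L)%N by exists (6 * L)%N.
have [m mE] : exists m, m = (576 * K ^ 16)%N by exists (576 * K ^ 16)%N.
have K0 : (0 < K)%N by rewrite KE LE.
have Kp : (0 < K ^ 16)%N by rewrite expn_gt0 K0.
have m4 : (4 <= m)%N by rewrite mE; apply: leq_trans (leq_pmulr 576 Kp).
have mr0 : 0 < m%:R :> R by rewrite ltr0n (leq_trans _ m4).
pose eps : R := (8%:R * m%:R ^+ 2)^-1.
have epsE : 8%:R * m%:R ^+ 2 * eps = 1 by rewrite divff // lt0r_neq0 // mulr_gt0 // exprn_gt0.
pose om : R := 1 - eps / 144%:R.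
have eps0 : 0 < eps by rewrite invr_gt0 mulr_gt0 // exprn_gt0.
have eps1 : eps <= 1.
  rewrite invf_le1 ?mulr_gt0 ?exprn_gt0 //.
  have m2 : 1 <= m%:R ^+ 2 :> R by rewrite exprn_ege1 // ler1n (leq_trans _ m4).
  by lra.
have om0 : 0 <= om by rewrite /om; lra.
have om1 : om < 1 by rewrite /om; lra.
(* This lets the same [k] control the lazy factor. The target 1/27 is chosen so that om^(k J)
   (3^J)^3 <= 1. *)
have om15 : 15%:R / 16%:R <= om by rewrite /om; lra.
have y0 : 0 < 1 / 27%:R :> R by rewrite divr_gt0.
have [k k0 omk] := expr_small om0 om1 y0.
exists (3%:R + (K%:R ^+ 16 + 1)), k; split => //.
  by rewrite !addr_ge0 // exprn_ge0.
move=> n h J hE JE n0 w.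
have hn : (16 * h <= n)%N by rewrite hE mulnC leq_divM.
have omQ : om ^+ h * (3 ^ J)%N%:R ^+ 3 <= 1.
  apply: le_trans (_ : (1 / 27%:R) ^+ J * (3 ^ J)%N%:R ^+ 3 <= _).
    apply: ler_wpM2r; first by rewrite exprn_ge0.
    apply: le_trans (_ : (om ^+ k) ^+ J <= _).
      rewrite -exprM; apply: ler_wiXn2l => //; first exact: ltW.
      by rewrite JE mulnC leq_divM.
    by apply: lerXn2r; rewrite ?nnegrE ?exprn_ge0 ?divr_ge0.
  rewrite natrX -exprM mulnC exprM -exprMn.
  rewrite [X in X ^+ J](_ : _ = 1) ?expr1n //.
  by rewrite !exprS expr0; field.
have decQ : (1 - eps / 144%:R) ^+ (h.*2 ./2) * (3 ^ J)%N%:R ^+ 3 <= 1 by rewrite doubleK.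
have d3 : (3 * h.*2 <= n)%N by clear -hn; lia.
have lazQ : (15%:R / 16%:R) ^+ (n - 3 * h.*2) * (3 ^ J)%N%:R <= 1 :> R.
  apply: le_trans omQ; have Q1 : 1 <= (3 ^ J)%N%:R :> R by rewrite ler1n expn_gt0.
  apply: ler_pM; rewrite ?exprn_ge0 ?divr_ge0 //; last first.
    by apply: ler_eXnr.
  apply: le_trans (_ : (15%:R / 16%:R) ^+ h <= _); last by apply: lerXn2r; rewrite ?nnegrE ?divr_ge0.
  by apply: ler_wiXn2l; [rewrite divr_ge0|exact: le_trans om15 (ltW om1)|clear -hn; lia].
have L0 : (0 < L)%N by rewrite LE.
exists (fun B => bad_sparse h.*2 w B || bad_rich R h.*2 J L w B); split.
  apply: le_trans (_ : sym_avg (fun B => (bad_sparse h.*2 w B)%:R + (bad_rich R h.*2 J L w B)%:R) <= _).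
    by apply: ler_sym_avg => B _; case: bad_sparse; case: bad_rich; rewrite ?addr0 ?add0r ?lerDl.
  rewrite sym_avgD mulrDl; apply: lerD.
    exact: le_trans (sym_bad_sparse_le R _ w) (sparse_bound hn).
  apply: le_trans (sym_bad_rich_le w cP epsE m4 L0 d3 decQ lazQ) _.
  exact: rich_bound_le LE KE mE hE JE.
move=> B; rewrite negb_or => /andP[ns nr] v t vp vE s; apply: ltW.
have L1 : (1 < L)%N by rewrite LE.
have := not_bad_small_ball cP n0 L1 ns nr vp vE s.
by rewrite LE.
Qed.

End Constants.

(** The step is applied with s = J, so that 2^s r decays like (2/3)^J. Its square root decays at
    rate 5/6, because 2/3 <= 25/36. *)
Lemma corank_step_decay (R : realFieldType) (C0 C1 D : R) t h J k :
  0 <= C0 -> 0 <= D -> C1 = 1 + (C0 + D) -> (J <= h)%N -> (h <= t)%N -> (0 < k)%N ->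
  small_ball t J (C0 * 2%:R^-1 ^+ h) (D / (3 ^ J)%N%:R) ->
  corank_prob R t.+1 k <= corank_prob R t k.+1 + (C0 + D + C1) * (5%:R / 6%:R) ^+ J.
Proof.
move=> C00 D0 C1E Jh ht k0 sbt.
have C10 : 0 <= C1 by rewrite C1E; lra.
have C11 : 1 <= C1 by rewrite C1E; lra.
have h0 : 0 <= 2%:R^-1 :> R by lra.
have h1 : 2%:R^-1 <= 1 :> R by lra.
have h23 : 2%:R^-1 <= 2%:R / 3%:R :> R by lra.
have h56 : 2%:R^-1 <= 5%:R / 6%:R :> R by lra.
have h13 : 1 / 3%:R <= 5%:R / 6%:R :> R by lra.
have h2356 : 2%:R / 3%:R <= (5%:R / 6%:R) ^+ 2 :> R by rewrite expr2; lra.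
have q0 : 0 <= C0 * 2%:R^-1 ^+ h by rewrite mulr_ge0 ?exprn_ge0.
have r0 : 0 <= D / (3 ^ J)%N%:R by rewrite divr_ge0.
have E0 : 0 <= C1 * (5%:R / 6%:R) ^+ J by rewrite mulr_ge0 ?exprn_ge0 ?divr_ge0.
have hJ (z : R) : 2%:R^-1 <= z -> 2%:R^-1 ^+ J <= z ^+ J.
  by move=> hz; apply: lerXn2r; rewrite ?nnegrE // (le_trans h0).
have qJ (z : R) : 2%:R^-1 <= z -> C0 * 2%:R^-1 ^+ h <= C0 * z ^+ J.
  move=> hz; apply: ler_wpM2l => //; apply: le_trans (hJ _ hz); exact: ler_wiXn2l.
have rE : D / (3 ^ J)%N%:R = D * (1 / 3%:R) ^+ J :> R.
  by rewrite natrX expr_div_n expr1n mul1r.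
have r23 : 2%:R ^+ J * (D / (3 ^ J)%N%:R) = D * (2%:R / 3%:R) ^+ J :> R.
  by rewrite rE mulrCA -exprMn mulrA mulr1.
have qE : 2%:R^-1 ^+ J + (C0 * 2%:R^-1 ^+ h + 2%:R ^+ J * (D / (3 ^ J)%N%:R)) <=
    (C1 * (5%:R / 6%:R) ^+ J) ^+ 2.
  rewrite r23; apply: le_trans (_ : C1 * (2%:R / 3%:R) ^+ J <= _).
    rewrite {1}C1E.
    by rewrite [leRHS]mulrDl [X in _ <= _ + X]mulrDl [1 * (_ ^+ J)]mul1r; apply: lerD (hJ _ h23) (lerD (qJ _ h23) (lexx _)).
  rewrite [leRHS]exprMn; apply: ler_pM; rewrite ?exprn_ge0 ?divr_ge0 //.
    by rewrite expr2; apply: ler_peMl.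
  by rewrite -exprM mulnC exprM; apply: lerXn2r; rewrite ?nnegrE ?exprn_ge0 ?divr_ge0.
apply: le_trans (corank_step q0 r0 E0 sbt (leq_trans Jh ht) qE k0) _.
rewrite lerD2l [leRHS]mulrDl lerD2r [leRHS]mulrDl; apply: lerD (qJ _ h56) _.
by rewrite rE; apply: (ler_wpM2l D0); apply: lerXn2r; rewrite ?nnegrE ?divr_ge0.
Qed.

(** Since 5/6 = (10/11)(11/12), Bernoulli's inequality lets (10/11)^j absorb the linear factor j + 1
    at the cost of 11. *)
Lemma linear_geometric_le (R : realFieldType) (C : R) (j l M : nat) :
  0 <= C -> (l <= M * j.+1)%N ->
  l%:R * (C * (5%:R / 6%:R) ^+ j) <= C * M%:R * 11%:R * (11%:R / 12%:R) ^+ j.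
Proof.
move=> C0 lM.
have lr : l%:R <= M%:R * j.+1%:R :> R by rewrite -natrM ler_nat.
have x0 : 0 <= 10%:R / 11%:R :> R by lra.
have x1 : 10%:R / 11%:R <= 1 :> R by lra.
have := expr_bernoulli j x0 x1.
have -> : 5%:R / 6%:R = (10%:R / 11%:R) * (11%:R / 12%:R) :> R by field.
have e0 : 0 <= (11%:R / 12%:R) ^+ j :> R by rewrite exprn_ge0 // divr_ge0.
have p0 : 0 <= (10%:R / 11%:R) ^+ j :> R by rewrite exprn_ge0.
rewrite [(10%:R / 11%:R * (_ / _)) ^+ j]exprMn; move: p0 e0; clear x0 x1; move: (_ ^+ j) ((11%:R / 12%:R) ^+ j) => p e p0 e0 bern.
have pj : p * j.+1%:R <= 11%:R by rewrite -natr1; move: bern p0; clear; lra.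
apply: le_trans (_ : M%:R * j.+1%:R * (C * (p * e)) <= _).
  by apply: ler_wpM2r => //; rewrite !mulr_ge0.
rewrite [leLHS](_ : _ = C * M%:R * (p * j.+1%:R) * e); last by ring.
by apply: ler_wpM2r => //; apply: ler_wpM2l => //; rewrite mulr_ge0.
Qed.

Lemma sing_prob_decay (R : archiRealFieldType) (c : nat -> int -> R) :
  (forall j, cosine_like (3 ^ j) (c j)) ->
  exists (C : R) (M : nat), [/\ 0 <= C, (0 < M)%N &
    forall n, sing_prob R n <= C * (11%:R / 12%:R) ^+ (n %/ M)].
Proof.
move=> cP; have [C0 [k [C00 k0 sb]]] := exists_small_ball cP.
have [D DE] : exists D : R, D = 480%:R by exists 480%:R.
have D0 : 0 <= D by rewrite DE ler0n.
have [C1 C1E] : exists C1, C1 = 1 + (C0 + D) by exists (1 + (C0 + D)).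
have [C2 C2E] : exists C2, C2 = C0 + D + C1 by exists (C0 + D + C1).
rewrite -DE in sb.
have C20 : 0 <= C2 by rewrite C2E C1E !addr_ge0.
pose b t : R := C2 * (5%:R / 6%:R) ^+ (t %/ 16 %/ k).
have step t l : (0 < t)%N -> (0 < l)%N -> corank_prob R t.+1 l <= corank_prob R t l.+1 + b t.
  move=> t0 l0; rewrite /b C2E.
  exact: corank_step_decay C00 D0 C1E (leq_div _ _) (leq_div _ _) l0 (sb t _ _ erefl erefl t0).
(* All sizes t involved are at least n/2, so 32 = 2 * 16 ensures that t / 16 / k is at least n /
   M. *)
have [M ME] : exists M, M = (32 * k)%N by exists (32 * k)%N.
have M0 : (0 < M)%N by rewrite ME muln_gt0.
have CM0 : 0 <= C2 * M%:R * 11%:R by rewrite !mulr_ge0.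
exists (C2 * M%:R * 11%:R + 1), M; split => // [|n]; first by rewrite addr_ge0.
have [j jE] : exists j, j = (n %/ M)%N by exists (n %/ M)%N.
(* For j = 0 the summand 1 in the constant suffices; otherwise n >= 32, and the starting size n/2 is
   positive. *)
rewrite -jE; have [j0|j0] := posnP j.
  rewrite j0 expr0 mulr1; apply: le_trans (ltW (sing_prob_lt1 R n)) _.
  by rewrite lerDr.
have nM : (n <= M * j.+1)%N by rewrite ltnW // mulnC -ltn_divLR // jE.
have jn : (32 * (j * k) <= n)%N by rewrite mulnCA -ME jE leq_divM.
have n32 : (32 <= n)%N.
  by apply: leq_trans jn; apply: leq_pmulr; rewrite muln_gt0 j0.
have [m mE] : exists m, m = n./2 by exists n./2.
have nE : n = (m + (n - m))%N by rewrite mE; clear; lia.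
have m_gt0 : (0 < m)%N by rewrite mE; clear -n32; lia.
have mm : (m <= n - m)%N by rewrite mE; clear; lia.
have jm : (j * (16 * k) <= m)%N by rewrite mulnCA mE; clear -jn; lia.
rewrite {1}nE; apply: le_trans (sing_prob_le_sum (b := b) _ mm) _.
  by move=> t l /andP[mt _]; apply: step; apply: leq_trans m_gt0 mt.
apply: le_trans (_ : \sum_(t < n - m) C2 * (5%:R / 6%:R) ^+ j <= _).
  apply: ler_sum => t _; apply: ler_wpM2l => //; apply: ler_wiXn2l.
  - by rewrite divr_ge0.
  - by rewrite ler_pdivrMr // mul1r ler_nat.
  - by rewrite -divnMA leq_divRL ?muln_gt0 //; apply: leq_trans (leq_addr _ _).
rewrite sumr_const card_ord -[_ *+ (n - m)]mulr_natl.
apply: le_trans (linear_geometric_le C20 (leq_trans (leq_subr m n) nM)) _.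
by apply: ler_wpM2r; rewrite ?exprn_ge0 ?divr_ge0 // lerDl.
Qed.

(** * The real cosine *)

Section RealCosine.
Local Notation R := Rdefinitions.R.
Local Arguments cos x%_ring_scope.
Local Arguments sin x%_ring_scope.

Lemma IZR_int (k : Z) : exists k' : int, IZR k = k'%:~R.
Proof.
case: k => [|p|p]; first by exists 0.
  by exists (nat_of_pos p)%:Z; rewrite IZRposE INRE.
exists (- (nat_of_pos p)%:Z); rewrite mulrNz -[(_%:Z)%:~R]INRE -IZRposE.
exact: (opp_IZR (Z.pos p)).
Qed.

Lemma cos_add_nat (a : R) (k : nat) : cos (a + 2 * PI * k%:R) = cos a.
Proof.
rewrite -(INRE k) -[RHS](cos_period a k); congr cos.
by rewrite RplusE !RmultE mulrAC.
Qed.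

Lemma cos_add_int (a : R) (k : int) : cos (a + 2 * PI * k%:~R) = cos a.
Proof.
case: k => k; first exact: cos_add_nat.
by rewrite NegzE -[LHS](cos_add_nat _ k.+1); congr cos; rewrite mulrNz -pmulrn mulrN addrNK.
Qed.

(** By cos 2y = 1 - 2 (sin y)^2, the hypothesis forces sin (PI a) = 0. *)
Lemma cos_eq1_int (a : R) : cos (2 * PI * a) = 1 -> exists k : int, a = k%:~R.
Proof.
move=> h; have : sin (PI * a) = 0.
  have sqr0 (F : realFieldType) (s : F) : 1 = 1 - 2 * s * s -> s = 0.
    by move=> e; apply/eqP; rewrite -[_ == 0]orbb -mulf_eq0; apply/eqP; lra.
  apply: sqr0; rewrite -[LHS]h -[2 * PI * a]mulrA; exact: cos_2a_sin.
move/sin_eq_0_0 => [k]; have [k' ->] := IZR_int k; rewrite RmultE mulrC => e; exists k'.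
apply: mulIf e; apply/eqP; exact: PI_neq0.
Qed.

Lemma cosine_like_cos (N : nat) : (0 < N)%N ->
  cosine_like N (fun x : int => cos (2 * PI * (x%:~R / N%:R))).
Proof.
move=> N0; have Nr : N%:R != 0 :> R by rewrite pnatr_eq0 -lt0n.
split=> [x y|x|x|x y /dvdzP[q ->]].
- rewrite rmorphD rmorphB /= [(x%:~R + _) / _]mulrDl [(x%:~R - _) / _]mulrDl mulNr.
  rewrite [2 * PI * (_ + _)]mulrDr [2 * PI * (_ - _)]mulrBr.
  move: (2 * PI * (x%:~R / _)) (2 * PI * (y%:~R / _)) => a b.
  have h1 : cos (a + b) = cos a * cos b - sin a * sin b by exact: cos_plus.
  have h2 : cos (a - b) = cos a * cos b + sin a * sin b by exact: cos_minus.
  by rewrite h1 h2 addrACA addNr addr0 -mulrA mulr_natl mulr2n.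
- have [h1 h2] := COS_bound (2 * PI * (x%:~R / N%:R)).
  by rewrite ler_norml; apply/andP; split; apply/RleP.
- apply/eqP/idP => [/cos_eq1_int[k e]|/dvdzP[q ->]].
    apply/dvdzP; exists k; apply/eqP; rewrite -(eqr_int R) rmorphM /= -e divfK //.
  by rewrite rmorphM /= mulfK // -[X in cos X]add0r cos_add_int; exact: cos_0.
- by rewrite rmorphD rmorphM /= [(x%:~R + _) / _]mulrDl mulfK // [2 * PI * (_ + _)]mulrDr cos_add_int.
Qed.

End RealCosine.

Lemma sing_prob_card (R : realFieldType) n :
  sing_prob R n = #|sym_sign_singular n|%:R / #|sym_sign n|%:R.
Proof.
rewrite /sing_prob /sym_avg mulrC; congr (_ / _).
rewrite -natr_sum -big_mkcondr /= -sum1_card; congr (_%:R).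
by apply: eq_bigl => B; rewrite !inE.
Qed.

(** * From geometric decay to the exponential bound *)

Section FinalBound.
Local Notation R := Rdefinitions.R.
Local Arguments exp x%_ring_scope.

Lemma exp_ge_pow (x y : R) (k : nat) : 0 <= 1 - y -> x <= y *+ k -> (1 - y) ^+ k <= exp (- x).
Proof.
move=> y0 xy; apply: le_trans (_ : exp (- y) ^+ k <= _).
  apply: lerXn2r; rewrite ?nnegrE //; first by apply/RleP/Rlt_le/exp_pos.
  by apply/RleP; exact: exp_ineq1_le.
rewrite expRX mulNrn; have [-> //|neq] := eqVneq (- (y *+ k)) (- x).
apply/RleP/Rlt_le/exp_increasing/RltP.
by rewrite lt_neqAle neq lerN2.
Qed.

Lemma sing_prob_exp : exists2 c : R, 0 < c & forall n, sing_prob R n <= exp (- (c * n%:R)).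
Proof.
have cP j : cosine_like (3 ^ j) (fun x : int => cos (2 * PI * (x%:~R / (3 ^ j)%N%:R))).
  by apply: cosine_like_cos; rewrite expn_gt0.
have [C [M [C0 M0 sC]]] := sing_prob_decay cP.
have x0 : 0 <= 22%:R / 23%:R :> R by rewrite divr_ge0.
have x1 : 22%:R / 23%:R < 1 :> R by rewrite ltr_pdivrMr // mul1r ltr_nat.
have C10 : 0 < C + 1 by rewrite ltr_wpDl.
have y0 : 0 < (23%:R / 24%:R) / (C + 1) by rewrite !divr_gt0.
have [k _ hk] := expr_small x0 x1 y0.
pose a : R := (24%:R * M%:R)^-1.
have a0 : 0 < a by rewrite invr_gt0 mulr_gt0 // ltr0n.
have big n : (k <= n %/ M)%N -> sing_prob R n <= exp (- (a * n%:R)).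
  set j := (n %/ M)%N => kj; apply: le_trans (sC n) _.
  (* The factor (22/23)^j absorbs the constant [C] and one extra factor 23/24, which is needed to
     reach the exponent j + 1 > n / M. *)
  have e23 : 11%:R / 12%:R = (22%:R / 23%:R) * (23%:R / 24%:R) :> R by field.
  have p0 : 0 <= 23%:R / 24%:R :> R by rewrite divr_ge0.
  apply: le_trans (_ : (23%:R / 24%:R) ^+ j.+1 <= _).
    rewrite -/j e23 exprMn exprSr [(22%:R / 23%:R) ^+ j * _]mulrC mulrCA; apply: ler_wpM2l; first by rewrite exprn_ge0.
    apply: le_trans (_ : C * ((23%:R / 24%:R) / (C + 1)) <= _).
      apply: ler_wpM2l => //; apply: le_trans hk.
      by apply: ler_wiXn2l => //; exact: ltW.
    rewrite mulrCA; apply: ler_piMr => //.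
    by rewrite ler_pdivrMr // mul1r lerDl.
  have -> : 23%:R / 24%:R = 1 - 1 / 24%:R :> R by field.
  apply: exp_ge_pow; first by rewrite subr_ge0 ler_pdivrMr // mul1r ler1n.
  have nM : n%:R <= M%:R * j.+1%:R :> R.
    by rewrite -natrM ler_nat ltnW // mulnC -ltn_divLR.
  have aM : a * M%:R = 1 / 24%:R.
    rewrite /a invfM -mulrA mulVf; first by rewrite mulr1 mul1r.
    by rewrite pnatr_eq0 -lt0n.
  apply: le_trans (ler_wpM2l (ltW a0) nM) _.
  by rewrite mulrA aM mulr_natr lexx.
have mono (c c' : R) n : c' <= c -> sing_prob R n <= exp (- (c * n%:R)) -> sing_prob R n <= exp (- (c' * n%:R)).
  move=> cc h; apply: le_trans h _.
  have [->|neq] := eqVneq (- (c * n%:R)) (- (c' * n%:R)) => //.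
  apply/RleP/Rlt_le/exp_increasing/RltP.
  by rewrite lt_neqAle neq lerN2 ler_wpM2r.
have small (B : nat) : exists2 c : R, 0 < c & forall n, (n < B)%N -> sing_prob R n <= exp (- (c * n%:R)).
  elim: B => [|B [c c0 IH]]; first by exists 1.
  have s1 := sing_prob_lt1 R B.
  (* With p the singularity probability at size [B], this choice gives p <= 1 - c1 B <= exp (- c1
     B). *)
  pose c1 : R := (1 - sing_prob R B) / B.+1%:R.
  have c10 : 0 < c1 by rewrite divr_gt0 ?subr_gt0.
  exists (Num.min c c1); first by rewrite lt_min c0.
  move=> n; rewrite ltnS leq_eqVlt => /orP[/eqP->|nB]; last first.
    by apply: (mono c); [rewrite ge_min lexx|exact: IH].
  apply: (mono c1); first by rewrite ge_min lexx orbT.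
  have c1B : c1 * B%:R <= 1 - sing_prob R B.
    rewrite /c1 mulrAC ler_pdivrMr // ; apply: ler_wpM2l; first by rewrite subr_ge0 ltW.
    by rewrite ler_nat.
  apply: le_trans (_ : 1 - c1 * B%:R <= _); first by rewrite lerBrDr addrC -lerBrDr.
  by apply/RleP; exact: exp_ineq1_le.
have [c c0 hc] := small (M * k)%N.
exists (Num.min a c); first by rewrite lt_min a0.
move=> n; have [nB|Bn] := ltnP n (M * k)%N.
  by apply: (mono c); [rewrite ge_min lexx orbT|exact: hc].
apply: (mono a); first by rewrite ge_min lexx.
by apply: big; rewrite leq_divRL // mulnC.
Qed.

End FinalBound.

Open Scope R_scope.

(* P(det A = 0) for A uniform on symmetric n x n (+-1)-matrices,
   = #singular / #all. *)
Theorem theorem1p1 :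
  exists c : R, 0 < c /\
    forall n : nat,
      INR #|sym_sign_singular n| / INR #|sym_sign n| <= exp (- (c * INR n)).
Proof.
have [c /RltP c0 bound] := sing_prob_exp; exists c; split => // n.
by rewrite !INRE -(INRE n); move/RleP: (bound n); rewrite sing_prob_card !INRE.
Qed.
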